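(* Let $n\ge 1$ be an integer, $0<\alpha<n$, let $\Phi,\Psi$ be Orlicz functions, and let either $0<\lambda,\mu<1$ with $\lambda\ne\mu$, or $\lambda=0$ and $0\le\mu<1$. Assume that there exist constants $C_1,C_2\ge 1$ such that $$\int_u^{\infty} t^{\frac{\alpha}{n}}\,\Phi^{-1}(t^{\lambda-1})\,\frac{dt}{t}\le C_1\,\Psi^{-1}(u^{\mu-1})\quad\text{for all } u>0$$ and $$u^{\frac{\alpha}{n}}\,\Phi^{-1}\Big(\frac{r^{\lambda}}{u}\Big)+\int_u^{r} t^{\frac{\alpha}{n}}\,\Phi^{-1}\Big(\frac{r^{\lambda}}{t}\Big)\,\frac{dt}{t}\le C_2\,\Psi^{-1}\Big(\frac{r^{\mu}}{u}\Big)\quad\text{for all } r>u>0.$$ (i) If $\Phi^*\in\Delta_2$, then the Riesz potential $I_\alpha$ is bounded from $M^{\Phi,\lambda}(0)$ to $M^{\Psi,\mu}(0)$, that is, there exists a constant $C_3=C_3(n,C_0,C_H,C_1,C_2)\ge 1$ such that $\|I_\alpha f\|_{M^{\Psi,\mu}(0)}\le C_3\,\|f\|_{M^{\Phi,\lambda}(0)}$ for all $f\in M^{\Phi,\lambda}(0)$. (ii) The operator $I_\alpha$ is bounded from $M^{\Phi,\lambda}(0)$ to $WM^{\Psi,\mu}(0)$, that is, there exists a constant $c_3=c_3(n,c_0,C_H,C_1,C_2)\ge 1$ such that $\|I_\alpha f\|_{WM^{\Psi,\mu}(0)}\le c_3\,\|f\|_{M^{\Phi,\lambda}(0)}$ for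 all $f\in M^{\Phi,\lambda}(0)$.
   Context: An Orlicz function is a strictly increasing, continuous, convex function $\Phi\colon[0,\infty)\to[0,\infty)$ with $\Phi(0)=0$; $\Phi^{-1}$ denotes its inverse, in general $\Phi^{-1}(v)=\inf\{u\ge0:\Phi(u)>v\}$ with $\inf\emptyset=\infty$. The complementary function of $\Phi$ is $\Phi^*(v)=\sup_{u>0}[uv-\Phi(u)]$ for $v\ge0$ (with values in $[0,\infty]$). A convex nondecreasing function $F\colon[0,\infty)\to[0,\infty]$ with $F(0)=0$ satisfies the $\Delta_2$-condition, written $F\in\Delta_2$, if $0<F(u)<\infty$ for all $u>0$ and there is a constant $D_2>1$ with $F(2u)\le D_2F(u)$ for all $u>0$. For $r>0$ let $B_r=\{x\in\mathbb{R}^n:|x|<r\}$, and let $|E|$ denote the Lebesgue measure of $E$. For $\lambda\in\mathbb{R}$, the central Morrey--Orlicz space $M^{\Phi,\lambda}(0)$ consists of all $f\in L^1_{loc}(\mathbb{R}^n)$ with $$\|f\|_{M^{\Phi,\lambda}(0)}=\sup_{r>0}\|f\|_{\Phi,\lambda,B_r}<\infty,\qquad \|f\|_{\Phi,\lambda,B_r}=\inf\Big\{\varepsilon>0:\frac{1}{|B_r|^{\lambda}}\int_{B_r}\Phi\Big(\frac{|f(x)|}{\varepsilon}\Big)dx\le1\Big\}.$$ The weak central Morrey--Orlicz space $WM^{\Phi,\lambda}(0)$ consists of all $f\in L^1_{loc}(\mathbb{R}^n)$ with $$\|f\|_{WM^{\Phi,\lambda}(0)}=\sup_{r>0}\|f\|_{\Phi,\lambda,B_r,\infty}<\infty,\qquad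 \|f\|_{\Phi,\lambda,B_r,\infty}=\inf\Big\{\varepsilon>0:\sup_{u>0}\Phi\Big(\frac{u}{\varepsilon}\Big)\frac{1}{|B_r|^{\lambda}}\,d(f\chi_{B_r},u)\le1\Big\},$$ where $d(g,u)=|\{x\in\mathbb{R}^n:|g(x)|>u\}|$. The Riesz potential is $I_\alpha f(x)=\int_{\mathbb{R}^n}\frac{f(y)}{|x-y|^{n-\alpha}}\,dy$, $x\in\mathbb{R}^n$. Constants: let $Mf(x)=\sup_{r>0}\frac{1}{|B(x,r)|}\int_{B(x,r)}|f(y)|\,dy$ be the centred Hardy--Littlewood maximal function, where $B(x,r)$ is the open ball with center $x$ and radius $r$. It is known that for an Orlicz function $\Phi$ and $0\le\lambda\le1$ there is a constant $c_0>1$ with $\|Mf\|_{WM^{\Phi,\lambda}(0)}\le c_0\|f\|_{M^{\Phi,\lambda}(0)}$ for all $f\in M^{\Phi,\lambda}(0)$, and, if $\Phi^*\in\Delta_2$, a constant $C_0>1$ with $\|Mf\|_{M^{\Phi,\lambda}(0)}\le C_0\|f\|_{M^{\Phi,\lambda}(0)}$ for all $f\in M^{\Phi,\lambda}(0)$; $c_0$ and $C_0$ denote such constants. Finally, $C_H=\frac{2^n}{2^\alpha-1}v_n$ with $v_n=|B(0,1)|=\pi^{n/2}/\Gamma(n/2+1)$. *)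

(* Defs.v *)
From HB Require Import structures.
From mathcomp Require Import all_boot all_order all_algebra.
From mathcomp Require Import all_classical all_reals all_analysis measurable_realfun.

Set Implicit Arguments.
Unset Strict Implicit.
Unset Printing Implicit Defensive.
Import Order.TTheory GRing.Theory Num.Theory.
Import numFieldNormedType.Exports.
Local Open Scope classical_set_scope.
Local Open Scope ring_scope.

Section cons_measure.
Context {R : realType} {n : nat}.
Variable m : {sigma_finite_measure set (n.-tuple R) -> \bar R}.

Definition cons_pair (p : R * n.-tuple R) : n.+1.-tuple R :=
  [the n.+1.-tuple R of p.1 :: p.2].

Lemma measurable_cons_pair : measurable_fun [set: R * n.-tuple R] cons_pair.
Proof.
exact: measurable_cons (@measurable_fst _ _ _ _) (@measurable_snd _ _ _ _).
Qed.

Definition cons_measure : set (n.+1.-tuple R) -> \bar R :=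
  pushforward (@lebesgue_measure R \x m)%E cons_pair.

Let cons_measure0 : cons_measure set0 = 0%E.
Proof. by rewrite /cons_measure /pushforward preimage_set0 measure0. Qed.

Let cons_measure_ge0 A : (0 <= cons_measure A)%E.
Proof. by rewrite /cons_measure /pushforward measure_ge0. Qed.

Let cons_measure_sigma_additive : semi_sigma_additive cons_measure.
Proof.
move=> F mF tF mUF; rewrite /cons_measure /pushforward preimage_bigcup.
have mpre A : measurable A -> measurable (cons_pair @^-1` A).
  by move=> mA; rewrite -[X in measurable X]setTI; exact: measurable_cons_pair.
apply: measure_semi_sigma_additive.
- by move=> k; apply: mpre; exact: mF.
- apply/trivIsetP => /= i j _ _ ij; rewrite -preimage_setI.
  by move/trivIsetP : tF => /(_ _ _ _ _ ij) ->//; rewrite preimage_set0.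
- by rewrite -preimage_bigcup; exact: mpre.
Qed.

HB.instance Definition _ := isMeasure.Build _ _ _ cons_measure
  cons_measure0 cons_measure_ge0 cons_measure_sigma_additive.

Let cons_measure_sigma_finite : sigma_finite setT cons_measure.
Proof.
have /sigma_finiteP[F [TF ndF Foo]] := sigma_finiteT (@lebesgue_measure R).
have /sigma_finiteP[G [TG ndG Goo]] := sigma_finiteT m.
pose split_tuple (t : n.+1.-tuple R) : R * n.-tuple R :=
  (tnth t ord0, [tuple of behead t]).
have msplit : measurable_fun [set: n.+1.-tuple R] split_tuple.
  by apply/measurable_fun_pairP; split;
    [exact: measurable_tnth | exact: measurable_behead].
have consK p : split_tuple (cons_pair p) = p.
  by case: p => x t; congr pair; exact: val_inj.
exists (fun k => split_tuple @^-1` (F k `*` G k)).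
  rewrite predeqE => t; split => // _.
  have [i _ Fi] : (\bigcup_i F i) (split_tuple t).1 by rewrite -TF.
  have [j _ Gj] : (\bigcup_i G i) (split_tuple t).2 by rewrite -TG.
  exists (maxn i j) => //; split.
  - by move: Fi; exact/subsetPset/ndF/leq_maxl.
  - by move: Gj; exact/subsetPset/ndG/leq_maxr.
move=> k; have [mFk Fkoo] := Foo k; have [mGk Gkoo] := Goo k; split.
  by rewrite -[X in measurable X]setTI; apply: msplit => //; exact: measurableX.
rewrite /cons_measure /pushforward -comp_preimage.
rewrite (_ : split_tuple \o cons_pair = id); last exact/funext.
rewrite preimage_id product_measure1E//.
by rewrite lte_mul_pinfty// ge0_fin_numE.
Qed.

HB.instance Definition _ := Measure_isSigmaFinite.Build _ _ _ cons_measure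
  cons_measure_sigma_finite.

End cons_measure.

Fixpoint borel_lebesgue (R : realType) (n : nat) :
    {sigma_finite_measure set (n.-tuple R) -> \bar R} :=
  match n with
  | 0 => \d_([tuple] : 0.-tuple R)
  | n'.+1 => cons_measure (borel_lebesgue R n')
  end.

(* R^n with the sigma-algebra of all Lebesgue measurable sets, that is, the
   Borel (product) one completed by the Caratheodory construction *)
Definition Rn (R : realType) (n : nat) :=
  caratheodory_type (mu_ext (borel_lebesgue R n)).
HB.instance Definition _ (R : realType) (n : nat) := Measurable.on (Rn R n).

Definition leb {R : realType} {n : nat} : set (Rn R n) -> \bar R :=
  @completed_measure_extension _ _ _ (borel_lebesgue R n).
HB.instance Definition _ (R : realType) (n : nat) := Measure.on (@leb R n).

Lemma leb_sigma_finite (R : realType) (n : nat) : sigma_finite setT (@leb R n).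
Proof. exact/completed_measure_extension_sigma_finite/sigma_finiteT. Qed.
HB.instance Definition _ (R : realType) (n : nat) :=
  @Measure_isSigmaFinite.Build _ _ _ (@leb R n) (leb_sigma_finite R n).

Section central_morrey_orlicz.
Context {R : realType}.
Implicit Types (Phi Psi : R -> R) (lambda : R).

(* Only the values on [0, +oo[ matter; the codomain condition Phi >= 0 there
   follows from strict monotonicity and Phi 0 = 0. *)
Definition orlicz_function Phi : Prop :=
  [/\ Phi 0 = 0,
      {in `[0, +oo[ &, {homo Phi : u v / u < v}},
      {within `[0, +oo[, continuous Phi} &
      convex_function (`[0, +oo[%classic : set R) Phi].

Definition generalized_inverse Phi (v : R) : \bar R :=
  ereal_inf [set u%:E | u in [set u | 0 <= u /\ v < Phi u]].

Definition complementary Phi (v : R) : \bar R :=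
  ereal_sup [set (u * v - Phi u)%:E | u in [set u | 0 < u]].

Definition Delta2 (F : R -> \bar R) : Prop :=
  (forall u : R, 0 < u -> (0 < F u < +oo)%E) /\
  exists2 D2 : R, 1 < D2 &
    forall u : R, 0 < u -> (F (2 * u)%R <= D2%:E * F u)%E.

Section space.
Context {n : nat}.
Implicit Types (f : Rn R n -> \bar R) (x y : Rn R n).

Definition edist x y : R :=
  Num.sqrt (\sum_(i < n) (tnth x i - tnth y i) ^+ 2).

Definition eball x (r : R) : set (Rn R n) := [set y | edist x y < r].

Definition origin : Rn R n := [tuple of nseq n 0].

Local Notation B r := (eball origin r).

(* Bounded sets are exactly the subsets of balls centered at the origin, so
   integrability over these balls is local integrability on R^n. *)
Definition L1loc f : Prop :=
  measurable_fun setT f /\ forall r, 0 < r -> leb.-integrable (B r) f.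

Definition luxemburg_norm Phi lambda (r : R) f : \bar R :=
  ereal_inf [set e%:E | e in [set e | 0 < e /\
    (((fine (leb (B r)) `^ lambda)^-1)%:E *
      \int[leb]_(x in B r) er_map Phi (`|f x| * (e^-1)%:E) <= 1)%E]].

Definition morrey_norm Phi lambda f : \bar R :=
  ereal_sup [set luxemburg_norm Phi lambda r f | r in [set r | 0 < r]].

Definition morrey_space Phi lambda : set (Rn R n -> \bar R) :=
  [set f | L1loc f /\ (morrey_norm Phi lambda f < +oo)%E].

Definition distribution_function f (u : R) : \bar R :=
  leb [set x | (u%:E < `|f x|)%E].

Definition weak_luxemburg_norm Phi lambda (r : R) f : \bar R :=
  ereal_inf [set e%:E | e in [set e | 0 < e /\
    (ereal_sup [set (Phi (u / e) * (fine (leb (B r)) `^ lambda)^-1)%:E *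
        distribution_function (fun x => f x * (\1_(B r) x)%:E) u
      | u in [set u : R | (0 < u)%R]] <= 1)%E]].

Definition weak_morrey_norm Phi lambda f : \bar R :=
  ereal_sup [set weak_luxemburg_norm Phi lambda r f | r in [set r | 0 < r]].

Definition weak_morrey_space Phi lambda : set (Rn R n -> \bar R) :=
  [set f | L1loc f /\ (weak_morrey_norm Phi lambda f < +oo)%E].

(* Where the integral does not converge absolutely (at a point x) it is an
   infinite value, so L1loc (riesz alpha f) implies that the Riesz potential is
   well defined almost everywhere. *)
Definition riesz (alpha : R) f x : \bar R :=
  \int[leb]_y (f y * ((edist x y `^ (n%:R - alpha))^-1)%:E)%E.

Definition maximal f x : \bar R :=
  ereal_sup [set ((leb (eball x r))^-1 * \int[leb]_(y in eball x r) `|f y|)%E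
    | r in [set r : R | 0 < r]].

End space.

Definition maximal_bound n Phi lambda (C : R) : Prop :=
  forall f : Rn R n -> \bar R, morrey_space Phi lambda f ->
  (morrey_norm Phi lambda (maximal f) <= C%:E * morrey_norm Phi lambda f)%E.

Definition weak_maximal_bound n Phi lambda (C : R) : Prop :=
  forall f : Rn R n -> \bar R, morrey_space Phi lambda f ->
  (weak_morrey_norm Phi lambda (maximal f)
    <= C%:E * morrey_norm Phi lambda f)%E.

Definition riesz_bound n (alpha : R) Phi lambda Psi (mu C : R) : Prop :=
  forall f : Rn R n -> \bar R, morrey_space Phi lambda f ->
  morrey_space Psi mu (riesz alpha f) /\
  (morrey_norm Psi mu (riesz alpha f) <= C%:E * morrey_norm Phi lambda f)%E.

Definition weak_riesz_bound n (alpha : R) Phi lambda Psi (mu C : R) : Prop :=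
  forall f : Rn R n -> \bar R, morrey_space Phi lambda f ->
  weak_morrey_space Psi mu (riesz alpha f) /\
  (weak_morrey_norm Psi mu (riesz alpha f)
    <= C%:E * morrey_norm Phi lambda f)%E.

Definition hedberg_constant (n : nat) (alpha : R) : R :=
  2 ^+ n / (2 `^ alpha - 1) * fine (leb (eball (@origin n) 1)).

End central_morrey_orlicz.

(* Main.v *)
Require Import Defs.
From mathcomp Require Import all_boot all_order all_algebra.
From mathcomp Require Import all_classical all_reals all_analysis measurable_realfun.
From mathcomp Require Import ring lra zify.
Set Implicit Arguments.
Unset Strict Implicit.
Import Order.TTheory GRing.Theory Num.Theory.
Import numFieldNormedType.Exports.
Local Open Scope classical_set_scope.
Local Open Scope ring_scope.

(* Fix r > 0, put R = (16 r)^n and, for f with e > ||f||, let g = |f| / e and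
   g1 = g 1_{B_2r}.  For x in B_r and u = (2 s)^n < R, splitting the Riesz kernel
   into dyadic shells and applying a Jensen type inequality on each of them turns the
   part |x - y| >= s of the potential into the integrals of the two hypotheses,
   so that
     I_alpha g (x) <= N_s g1 (x) + A Psi^-1 (R^mu / u),
   where N_s is the convolution with the kernel truncated to |x - y| < s, an
   operator of norm at most C s^alpha on L^1 and on L^infty.
   Weak type: with Phi(tau) = R^lambda / u, split g1 at height tau; the bounded
   part of N_s g1 is absorbed by Psi^-1 (R^mu / u) thanks to the second hypothesis,
   and Markov's inequality controls the rest.  Thus no maximal function is needed.
   Strong type: summing the same estimate over the heights tau_0 L^k is a
   geometric series as soon as Phi(L w) >= 2 L Phi(w), which is what the Delta_2
   condition on the complementary function provides.
   When a maximal bound is given, N_s g1 <= C s^alpha M g (Hedberg) and u is chosen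
   pointwise with Phi(M g / C0) comparable to R^lambda / u, which makes the
   constant depend only on n, C0, C_H, C1 and C2. *)

(** The hypotheses are written in a volume variable t, the potential in radii w; the dictionary is t
    = (c w)^n, and ball volumes are only compared with those of a circumscribed and an inscribed
    cube. The radius 16 r has two reasons. Every dyadic shell around x that can meet B_2r keeps its
    volume variable below R = (16 r)^n, where the integral in the second hypothesis stops. The tail,
    which starts at distance 2 r from the origin, has its volume variable start exactly at R, where
    the first hypothesis is applied. The price is R^mu in place of |B_r|^mu, a dimensional factor
    that the convexity of Psi moves into the norm constant. There are two strong bounds because the
    ratio L obtained from the Delta_2 condition depends on Phi: it yields boundedness without any
    maximal bound, but not a constant that is uniform in Phi. The exponent alpha enters the
    constants only through 4^n / (2^alpha - 1), which is a function of n and C_H; this is why alpha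
    need not be an argument of the final constants. *)

Local Notation edist := Defs.edist.

(** * Integrals of nonnegative, possibly non-measurable functions *)

Section integral_tools.
Context d (T : measurableType d) (R : realType) (m : {measure set T -> \bar R}).
Local Open Scope ereal_scope.

(** A nonnegative integral is the supremum over the simple functions below the integrand, so
    monotonicity costs no measurability. This is what allows integrands built from a maximal
    function. *)
Lemma ge0_le_integral_nomeas (D : set T) (f g : T -> \bar R) :
  (forall x, D x -> 0 <= f x) -> (forall x, D x -> f x <= g x) ->
  \int[m]_(x in D) f x <= \int[m]_(x in D) g x.
Proof.
move=> f0 fg; have g0 x : D x -> 0 <= g x.
  by move=> Dx; exact: le_trans (f0 _ Dx) (fg _ Dx).
rewrite !ge0_integralE//; apply: le_ereal_sup => _ [h hf <-]; exists h => // x.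
apply: le_trans (hf x) _; rewrite !patchE; case: ifPn => // /set_mem; exact: fg.
Qed.

Lemma ge0_subset_integral_nomeas (A B : set T) (f : T -> \bar R) :
  (forall x, B x -> 0 <= f x) -> A `<=` B ->
  \int[m]_(x in A) f x <= \int[m]_(x in B) f x.
Proof.
move=> f0 AB; rewrite integral_mkcond [leRHS]integral_mkcond.
apply: ge0_le_integral_nomeas => x _; rewrite !patchE.
  by case: ifPn => // /set_mem/AB/f0.
case: ifPn => [/set_mem/AB/mem_set ->//|_]; case: ifPn => // /set_mem; exact: f0.
Qed.

Lemma ge0_markov (D : set T) (f : T -> \bar R) (a : R) :
  measurable D -> measurable_fun D f -> (forall x, D x -> 0 <= f x) ->
  (0 < a)%R ->
  a%:E * m (D `&` [set x | a%:E < f x]) <= \int[m]_(x in D) f x.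
Proof.
move=> mD mf f0 a0.
have mE : measurable (D `&` [set x | a%:E < f x]).
  exact: emeasurable_fun_o_infty.
rewrite -integral_cst//.
apply: (@le_trans _ _ (\int[m]_(x in D `&` [set x | a%:E < f x]) f x)); last first.
  exact: (ge0_subset_integral_nomeas f0 (@subIsetl _ D [set x | a%:E < f x])).
apply: ge0_le_integral_nomeas => [x _|x [_ /ltW //]].
by rewrite /= lee_fin ltW.
Qed.

End integral_tools.

(** * Lebesgue measure of cubes and Euclidean balls *)

Section ball_measure.
Context (R : realType).
Local Open Scope ereal_scope.

Definition cube n (c : n.-tuple R) (r : R) : set (n.-tuple R) :=
  [set t | forall i, (tnth t i \in `]tnth c i - r, tnth c i + r[)%R].

Lemma measurable_cube n (c : n.-tuple R) (r : R) : measurable (cube c r).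
Proof.
rewrite (_ : cube c r = \bigcap_(i in [set: 'I_n])
    ((fun t => tnth t i) @^-1` [set` `]tnth c i - r, tnth c i + r[%R])); last first.
  by apply/seteqP; split => t /= H i; [move=> _|]; exact: H.
apply: fin_bigcap_measurable => // i _.
by rewrite -[X in measurable X]setTI; exact: measurable_tnth.
Qed.

(** Induction along [cons_measure]: a cube is an interval times a cube of lower dimension. In
    dimension 0 the measure is a Dirac mass and the cube is the whole one-point space, which agrees
    with (2 r)^0 = 1. *)
Lemma borel_lebesgue_cube n (c : n.-tuple R) (r : R) : (0 <= r)%R ->
  borel_lebesgue R n (cube c r) = ((2 * r) ^+ n)%:E.
Proof.
move=> r0; elim: n c => [|n IH] c.
  by rewrite /= diracE mem_set// => -[].
transitivity ((@lebesgue_measure R \x borel_lebesgue R n)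
    ([set` `]tnth c ord0 - r, tnth c ord0 + r[%R] `*` cube [tuple of behead c] r)).
  congr ((@lebesgue_measure R \x borel_lebesgue R n) _).
  have tb i : tnth [tuple of behead c] i = tnth c (lift ord0 i).
    rewrite tnth_behead; congr (tnth c _); apply: val_inj.
    by rewrite /= inordK// ltnS.
  apply/seteqP; split => -[x t].
    move=> H; split => [|i] /=; first by have := H ord0; rewrite tnth0.
    by have := H (lift ord0 i); rewrite tnthS tb.
  move=> [Hx Ht] i; case: (unliftP ord0 i) => [j|] ->; last by rewrite tnth0.
  by have := Ht j; rewrite tnthS tb.
rewrite product_measure1E//; last exact: measurable_cube.
transitivity ((2 * r)%:E * ((2 * r) ^+ n)%:E); last by rewrite -EFinM exprS.
congr (_ * _); last exact: IH.
rewrite [LHS]lebesgue_measure_itv /= lte_fin; case: ltP => h.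
  by rewrite -EFinB; congr _%:E; ring.
by congr _%:E; lra.
Qed.

End ball_measure.

Section euclidean_balls.
Context {R : realType} {n : nat}.
Implicit Types (x y z : Rn R n).

Lemma measurable_Rn (A : set (n.-tuple R)) :
  measurable A -> measurable (A : set (Rn R n)).
Proof. by move=> mA; apply: sub_caratheodory; exact: sub_sigma_algebra. Qed.

Lemma lebE (A : set (n.-tuple R)) :
  measurable A -> leb (A : set (Rn R n)) = borel_lebesgue R n A.
Proof. by move=> mA; exact: measurable_mu_extE. Qed.

Lemma measurable_Rn_tnth (i : 'I_n) :
  measurable_fun [set: Rn R n] (fun x => tnth x i).
Proof.
move=> _ Y mY; apply: measurable_Rn.
exact: (@measurable_tnth _ _ n i measurableT Y mY).
Qed.

Lemma edist_sym x y : edist x y = edist y x.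
Proof.
by congr Num.sqrt; apply: eq_bigr => i _; rewrite -sqrrN opprB.
Qed.

Lemma edist_ge0 x y : 0 <= edist x y.
Proof. exact: sqrtr_ge0. Qed.

Lemma sqr_edist x y : edist x y ^+ 2 = \sum_(i < n) (tnth x i - tnth y i) ^+ 2.
Proof. by rewrite sqr_sqrtr// sumr_ge0// => i _; rewrite sqr_ge0. Qed.

Lemma tnth_le_edist x y i : `|tnth x i - tnth y i| <= edist x y.
Proof.
rewrite -ler_sqr ?nnegrE ?edist_ge0// sqr_edist real_normK ?num_real//.
by rewrite (bigD1 i)//= lerDl sumr_ge0// => j _; rewrite sqr_ge0.
Qed.

(** Cauchy-Schwarz is replaced by a weighted Young inequality in each coordinate, (p + q)^2 <= (1 +
    b/a) p^2 + (1 + a/b) q^2, where a and b are the two distances on the right. With these weights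
    the sum over the coordinates is exactly (a + b)^2. They require a and b to be nonzero, hence the
    two cases of coinciding points. *)
Lemma edist_triangle y x z : edist x z <= edist x y + edist y z.
Proof.
have [xy0|xy0] := eqVneq (edist x y) 0.
  suff -> : x = y by rewrite lerDr edist_ge0.
  apply: eq_from_tnth => i; apply/eqP; rewrite -subr_eq0 -normr_le0 -xy0.
  exact: tnth_le_edist.
have [yz0|yz0] := eqVneq (edist y z) 0.
  suff -> : y = z by rewrite lerDl edist_ge0.
  apply: eq_from_tnth => i; apply/eqP; rewrite -subr_eq0 -normr_le0 -yz0.
  exact: tnth_le_edist.
have a0 : 0 < edist x y by rewrite lt_def xy0 edist_ge0.
have b0 : 0 < edist y z by rewrite lt_def yz0 edist_ge0.
set a := edist x y in a0 *; set b := edist y z in b0 *.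
rewrite -ler_sqr ?nnegrE ?edist_ge0 ?addr_ge0 ?(ltW a0) ?(ltW b0)//.
have -> : (a + b) ^+ 2 = (1 + b / a) * a ^+ 2 + (1 + a / b) * b ^+ 2.
  by field; rewrite ?(lt0r_neq0 a0) ?(lt0r_neq0 b0).
rewrite /a /b !sqr_edist -/a -/b !mulr_sumr -big_split/=.
apply: ler_sum => i _.
set u := tnth x i; set v := tnth y i; set w := tnth z i.
have -> : u - w = (u - v) + (v - w) by ring.
move: (u - v) (v - w) => p q; rewrite -subr_ge0.
have -> : (1 + b / a) * p ^+ 2 + (1 + a / b) * q ^+ 2 - (p + q) ^+ 2 =
  (b * p - a * q) ^+ 2 / (a * b).
  by field; rewrite ?(lt0r_neq0 a0) ?(lt0r_neq0 b0).
by rewrite divr_ge0 ?sqr_ge0// mulr_ge0 ?ltW.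
Qed.

Lemma measurable_edist :
  measurable_fun [set: Rn R n * Rn R n] (fun p => edist p.1 p.2).
Proof.
apply: (@measurableT_comp _ _ _ _ _ _ (@Num.sqrt R)).
  by apply: nondecreasing_measurable => // a b; exact: ler_wsqrtr.
apply: measurable_sum => i; apply: measurable_funX; apply: measurable_funB.
- apply: (measurableT_comp (measurable_Rn_tnth i)); exact: measurable_fst.
- apply: (measurableT_comp (measurable_Rn_tnth i)); exact: measurable_snd.
Qed.

Lemma measurable_edistr x : measurable_fun [set: Rn R n] (edist x).
Proof.
exact: (measurableT_comp measurable_edist (measurable_pair1 x)).
Qed.

Lemma measurable_eball x r : measurable (eball x r).
Proof.
rewrite (_ : eball x r = [set: Rn R n] `&` edist x @^-1` `]-oo, r[).
  exact: measurable_edistr.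
by rewrite setTI; apply/seteqP; split => u /=; rewrite in_itv/=.
Qed.

Lemma measurable_edist_ge x r : measurable [set y : Rn R n | r <= edist x y].
Proof.
rewrite (_ : mkset _ = ~` eball x r); first exact/measurableC/measurable_eball.
by apply/seteqP; split => y /=; rewrite /eball/= leNgt => /negP.
Qed.

Lemma leb_cube x r : 0 <= r -> leb (cube x r : set (Rn R n)) = ((2 * r) ^+ n)%:E.
Proof.
by move=> r0; rewrite lebE ?borel_lebesgue_cube//; exact: measurable_cube.
Qed.

Lemma leb_eball_le x r : 0 <= r -> (leb (eball x r) <= ((2 * r) ^+ n)%:E)%E.
Proof.
move=> r0; rewrite -(leb_cube x)//; apply: le_measure.
- exact/mem_set/measurable_eball.
- by apply/mem_set; exact: (measurable_Rn (measurable_cube x _)).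
- move=> y /= yr i; have := le_lt_trans (tnth_le_edist x y i) yr.
  by rewrite in_itv/= -ltr_distl distrC.
Qed.

(** The cube of half-side r / (n + 1) lies in the ball because n (r / (n + 1))^2 < r^2; the exact
    volume of the ball is avoided. *)
Lemma leb_eball_ge x r : (1 <= n)%N -> 0 < r ->
  (((2 * r / n.+1%:R) ^+ n)%:E <= leb (eball x r))%E.
Proof.
move=> n1 r0; rewrite -mulrA -(leb_cube x); last by rewrite divr_ge0// ltW.
apply: le_measure.
- by apply/mem_set; exact: (measurable_Rn (measurable_cube x _)).
- exact/mem_set/measurable_eball.
- move=> y /= H; rewrite /eball/=.
  rewrite -ltr_sqr ?nnegrE ?edist_ge0 ?(ltW r0)// sqr_edist.
  apply: (@le_lt_trans _ _ (\sum_(i < n) (r / n.+1%:R) ^+ 2)).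
    apply: ler_sum => i _; rewrite -[leLHS]real_normK ?num_real// ler_sqr ?nnegrE//.
      by have := H i; rewrite in_itv/= -ltr_distl distrC => /ltW.
    by rewrite divr_ge0// ltW.
  rewrite sumr_const card_ord -(mulr_natr (_ ^+ 2)) expr_div_n mulrAC.
  rewrite ltr_pdivrMr ?exprn_gt0// ltr_pM2l ?exprn_gt0//.
  by rewrite -natrX ltr_nat; nia.
Qed.

Lemma leb_eball_fin x r : leb (eball x r) \is a fin_num.
Proof.
rewrite ge0_fin_numE//; have [r0|r0] := leP 0 r.
  by apply: le_lt_trans (leb_eball_le x r0) _; rewrite ltry.
rewrite (_ : eball x r = set0) ?measure0//; apply/seteqP; split => y //=.
by rewrite /eball/= => /(le_lt_trans (edist_ge0 _ _))/(lt_trans r0); rewrite ltxx.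
Qed.

Lemma leb_eball_gt0 x r : (1 <= n)%N -> 0 < r -> 0 < fine (leb (eball x r)).
Proof.
move=> n1 r0; rewrite -lte_fin fineK ?leb_eball_fin//.
apply: lt_le_trans (leb_eball_ge x n1 r0).
by rewrite lte_fin exprn_gt0// divr_gt0// mulr_gt0.
Qed.

End euclidean_balls.

(** * Nonnegative series and dyadic localization *)

Section series_tools.
Context {R : realType}.

Lemma nneseries_le_ub (u : nat -> \bar R) (M : \bar R) :
  (forall i, 0 <= u i)%E -> (forall N, \sum_(0 <= i < N) u i <= M)%E ->
  (\sum_(0 <= i <oo) u i <= M)%E.
Proof.
move=> u0 uM; apply: lime_le; first by apply: is_cvg_nneseries => i _ _; exact: u0.
by apply: nearW => N; exact: uM.
Qed.

Lemma nneseries_ge_term (u : nat -> \bar R) (j : nat) :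
  (forall i, 0 <= u i)%E -> (u j <= \sum_(0 <= i <oo) u i)%E.
Proof.
move=> u0; apply: le_trans (nneseries_lim_ge j.+1 (fun i _ _ => u0 i)).
by rewrite big_nat_recr//= leeDr// sume_ge0.
Qed.

Lemma geometric_partial_sum_le (z : R) N : 1 < z ->
  \sum_(0 <= j < N) (z ^+ j.+1)^-1 <= (z - 1)^-1.
Proof.
move=> z1; have z0 : 0 < z by lra.
have -> : \sum_(0 <= j < N) (z ^+ j.+1)^-1 = (z - 1)^-1 * (1 - (z ^+ N)^-1).
  elim: N => [|N IH]; first by rewrite big_nil expr0 invr1 subrr mulr0.
  rewrite big_nat_recr//= IH exprS; field.
  by rewrite expf_neq0 ?lt0r_neq0//; lra.
rewrite ger_pMr ?invr_gt0; last lra.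
by rewrite gerBl invr_ge0 exprn_ge0// ltW.
Qed.

Lemma expr2_unbounded (a : R) : exists j : nat, a < 2 ^+ j.
Proof.
exists (Num.truncn `|a|).+1; apply: le_lt_trans (ler_norm _) _.
apply: lt_le_trans (truncnS_gt _) _.
by rewrite -natrX ler_nat ltnW// ltn_expl.
Qed.

Lemma dyadic_shell_above (s w : R) : 0 < s -> s <= w ->
  exists j : nat, s * 2 ^+ j <= w < s * 2 ^+ j.+1.
Proof.
move=> s0 sw.
have ex : exists j : nat, w < s * 2 ^+ j.+1.
  have [j hj] := expr2_unbounded (w / s); exists j.
  rewrite mulrC -ltr_pdivrMr//; apply: lt_trans hj _.
  by rewrite ltr_eXn2l// ltrDl.
case: (ex_minnP ex) => -[|j] wj min; [exists 0%N|exists j.+1].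
  by rewrite wj expr0 mulr1 sw.
by rewrite wj andbT leNgt; apply/negP => /min; rewrite ltnn.
Qed.

Lemma dyadic_shell_below (s w : R) : 0 < w -> w < s ->
  exists j : nat, s / 2 ^+ j.+1 <= w < s / 2 ^+ j.
Proof.
move=> w0 ws.
have ex : exists j : nat, s / 2 ^+ j.+1 <= w.
  have [j hj] := expr2_unbounded (s / w); exists j.
  rewrite ler_pdivrMr ?exprn_gt0// mulrC -ler_pdivrMr//.
  by apply: ltW; apply: lt_trans hj _; rewrite ltr_eXn2l// ltrDl.
case: (ex_minnP ex) => -[|j] wj min; [exists 0%N|exists j.+1].
  by rewrite wj expr0 divr1.
by rewrite wj ltNge; apply/negP => /min; rewrite ltnn.
Qed.

End series_tools.

(** * Dyadic decomposition of integrals against the kernel w^(alpha - n) *)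

Section dyadic_sums.
Context d (T : measurableType d) (R : realType) (m : {measure set T -> \bar R}).
Variables (n : nat) (alpha : R) (w : T -> R).
Hypotheses (alpha0 : 0 < alpha) (w0 : forall y, 0 <= w y).
Hypothesis mw : measurable_fun setT w.
Let beta := n%:R - alpha.

Let measurable_ltw s : measurable [set y | w y < s].
Proof.
rewrite (_ : [set y | w y < s] = [set: T] `&` w @^-1` `]-oo, s[).
  exact: mw.
by rewrite setTI; apply/seteqP; split => u /=; rewrite in_itv/=.
Qed.

Let measurable_gew s : measurable [set y | s <= w y].
Proof.
rewrite (_ : [set y | s <= w y] = [set: T] `&` w @^-1` `[s, +oo[).
  exact: mw.
by rewrite setTI; apply/seteqP; split => u /=; rewrite in_itv/= andbT.
Qed.

Lemma powR_split (a : R) : 0 < a -> a ^+ n = a `^ beta * a `^ alpha.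
Proof.
by move=> a0; rewrite -powRD ?subrK ?powR_mulrn ?(ltW a0)// (gt_eqF a0) implybT.
Qed.

Lemma powR_exprn (a : R) k : 0 <= a -> (a ^+ k) `^ alpha = (a `^ alpha) ^+ k.
Proof.
move=> a0; rewrite -(powR_mulrn k a0) -(powR_mulrn k (powR_ge0 a alpha)).
by rewrite -(powRrM a k%:R alpha) -(powRrM a alpha k%:R) mulrC.
Qed.

Lemma powR_div_exprn (s : R) k : 0 < s ->
  (s / 2 ^+ k) `^ alpha = s `^ alpha / (2 `^ alpha) ^+ k.
Proof.
move=> s0; have e0 : 0 <= 2 ^+ k :> R by rewrite exprn_ge0.
rewrite -(powR_exprn k (ler0n _ 2)) powRM ?(ltW s0) ?invr_ge0//; congr (_ * _).
by rewrite -(powR_inv1 e0) -powRrM -powRN mulN1r.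
Qed.

Lemma powR2_gt1 : 1 < 2 `^ alpha.
Proof.
have h := @gt0_ltr_powR R _ alpha0 1 2.
by rewrite powR1 in h; apply: h; rewrite ?nnegrE// ltr1n.
Qed.

Lemma powR_root (a : R) : (0 < n)%N -> 0 <= a ->
  (a ^+ n) `^ (alpha / n%:R) = a `^ alpha.
Proof.
move=> n0 a0; rewrite -powR_mulrn// -powRrM mulrCA mulfV ?mulr1//.
by rewrite pnatr_eq0 -lt0n.
Qed.

Local Open Scope ereal_scope.

(** On the shell s / 2^(j+1) <= w < s / 2^j the kernel is at most its value at the inner radius, and
    g is integrated over the whole ball w < s / 2^j so that the growth hypothesis applies. The
    resulting series is geometric with ratio 2^(-alpha), whence the factor 1 / (2^alpha - 1). *)
Lemma near_sum_le (g : T -> \bar R) (s : R) (Q : \bar R) :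
  measurable_fun setT g -> (forall y, 0 <= g y) -> (0 < s)%R -> 0 <= Q ->
  (0 < beta)%R ->
  (forall r : R, (0 < r)%R ->
     \int[m]_(y in [set y | (w y < r)%R]) g y <= ((2 * r) ^+ n)%:E * Q) ->
  \int[m]_(y in [set y | (w y < s)%R]) (g y * ((w y `^ beta)^-1)%:E) <=
  ((4 ^+ n / (2 `^ alpha - 1)) * s `^ alpha)%:E * Q.
Proof.
move=> mg g0 s0 Q0 beta0 H.
pose c j : R := (((s / 2 ^+ j.+1) `^ beta)^-1)%R.
pose A j : set T := [set y | (w y < s / 2 ^+ j)%R].
have sj j : (0 < s / 2 ^+ j)%R by rewrite divr_gt0// exprn_gt0.
have c0 j : (0 <= c j)%R by rewrite invr_ge0 powR_ge0.
have mA j : measurable (A j) by exact: measurable_ltw.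
pose F j y := (c j)%:E * (g \_ (A j)) y.
have F0 j y : 0 <= F j y.
  by rewrite mule_ge0// ?lee_fin// patchE; case: ifPn.
have mF j : measurable_fun setT (F j).
  apply: emeasurable_funM => //.
  apply/(measurable_restrictT _ _).1 => //; exact: measurable_funTS.
apply: (@le_trans _ _ (\int[m]_y \sum_(0 <= j <oo) F j y)).
  rewrite integral_mkcond; apply: ge0_le_integral_nomeas => y _.
    by rewrite patchE; case: ifPn => // _; rewrite mule_ge0// lee_fin invr_ge0 powR_ge0.
  rewrite patchE; case: ifPn => [/set_mem/= wys|_]; last exact: nneseries_ge0.
  (* A point with w = 0 lies in no shell. There 0^beta = 0 and the inverse of 0 is 0, so the
     integrand vanishes. *)
  have [wy0|wy0] := eqVneq (w y) 0%R.
    by rewrite wy0 powR0 ?gt_eqF// invr0 mule0 nneseries_ge0.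
  have {wy0} wy0 : (0 < w y)%R by rewrite lt_def wy0 w0.
  have [j /andP[j1 j2]] := dyadic_shell_below wy0 wys.
  apply: le_trans (nneseries_ge_term j _) => //.
  rewrite /F patchE mem_set// muleC lee_wpmul2r// lee_fin /c.
  by rewrite lef_pV2 ?posrE ?powR_gt0// ge0_ler_powR// ?nnegrE ltW.
rewrite integral_nneseries//; apply: nneseries_le_ub => [i|N].
  by apply: integral_ge0.
apply: (@le_trans _ _ (\sum_(0 <= i < N)
    ((4 ^+ n * s `^ alpha * ((2 `^ alpha) ^+ i.+1)^-1)%:E * Q))).
  apply: lee_sum => j _; rewrite ge0_integralZl//; last 3 first.
  - apply/(measurable_restrictT _ _).1 => //; exact: measurable_funTS.
  - by move=> y _; rewrite patchE; case: ifPn.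
  - by rewrite lee_fin.
  rewrite -integral_mkcond.
  apply: le_trans (lee_wpmul2l _ (H _ (sj j))) _; rewrite ?lee_fin//.
  rewrite muleA -EFinM lee_wpmul2r// lee_fin /c.
  (* With a the inner radius of the shell, the volume factor is (4 a)^n = 4^n a^beta a^alpha, and
     a^beta cancels against [c j]. *)
  have -> : (2 * (s / 2 ^+ j) = 4 * (s / 2 ^+ j.+1))%R.
    by rewrite exprS; field; rewrite expf_neq0.
  rewrite exprMn (powR_split (sj _)) mulrCA (mulrA (_^-1)%R) mulVf ?mul1r.
    by rewrite powR_div_exprn// mulrA.
  by rewrite gt_eqF// powR_gt0.
rewrite -ge0_sume_distrl; last first.
  by move=> i _; rewrite lee_fin !mulr_ge0 ?powR_ge0 ?exprn_ge0// invr_ge0 exprn_ge0 ?powR_ge0.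
rewrite lee_wpmul2r// sumEFin lee_fin -mulr_sumr [leRHS]mulrAC ler_wpM2l//.
  by rewrite mulr_ge0 ?powR_ge0 ?exprn_ge0.
apply: geometric_partial_sum_le.
exact: powR2_gt1.
Qed.

(** Each shell is compared with the integral over the interval from [b j] to [b j.+1]. As p is
    nonincreasing, the integrand there is at least b_j^(alpha/n) p(b_(j+1)) / b_(j+1), and since n
    >= 1 the interval is at least half as long as its right endpoint. That half and the factor 2 in
    the shell hypothesis make the 4; (2 M)^n comes from b_(j+1) = (2 M)^n (s 2^j)^n. *)
Lemma shell_sum_le (g : T -> \bar R) (p : R -> R) (s M : R) :
  measurable_fun setT g -> (forall y, 0 <= g y) -> (0 < s)%R -> (1 <= M)%R ->
  (0 < n)%N -> (0 < beta)%R ->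
  (forall t, (0 < t)%R -> (0 <= p t)%R) ->
  (forall t u, (0 < t)%R -> (t <= u)%R -> (p u <= p t)%R) ->
  measurable_fun setT p ->
  let b j := ((M * (s * 2 ^+ j)) ^+ n)%R in
  (forall j : nat, \int[m]_(y in [set y | (s * 2 ^+ j <= w y < s * 2 ^+ j.+1)%R]) g y
     <= (2 * b j.+1 * p (b j.+1))%:E) ->
  \int[m]_(y in [set y | (s <= w y)%R]) (g y * ((w y `^ beta)^-1)%:E) <=
  (4 * (2 * M) ^+ n)%:E *
    \int[lebesgue_measure]_(t in `]((M * s) ^+ n)%R, +oo[)
       (t `^ (alpha / n%:R) * p t * t^-1)%:E.
Proof.
move=> mg g0 s0 M1 n0 beta0 p0 pd mp b H.
have M0 : (0 < M)%R by lra.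
pose c j : R := (((s * 2 ^+ j) `^ beta)^-1)%R.
pose A j : set T := [set y | (s * 2 ^+ j <= w y < s * 2 ^+ j.+1)%R].
have sj j : (0 < s * 2 ^+ j)%R by rewrite mulr_gt0// exprn_gt0.
have c0 j : (0 <= c j)%R by rewrite invr_ge0 powR_ge0.
have mA j : measurable (A j).
  rewrite (_ : A j = [set y | (s * 2 ^+ j <= w y)%R] `&` [set y | (w y < s * 2 ^+ j.+1)%R]).
    exact: measurableI (measurable_gew _) (measurable_ltw _).
  by apply/seteqP; split => y /=; [move/andP|move=> ?; exact/andP].
pose F j y := (c j)%:E * (g \_ (A j)) y.
have F0 j y : 0 <= F j y.
  by rewrite mule_ge0// ?lee_fin// patchE; case: ifPn.
have mF j : measurable_fun setT (F j).
  apply: emeasurable_funM => //.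
  apply/(measurable_restrictT _ _).1 => //; exact: measurable_funTS.
have b0 j : (0 < b j)%R by rewrite exprn_gt0// mulr_gt0.
have bS j : b j.+1 = (2 ^+ n * b j)%R.
  by rewrite /b -exprMn exprS; congr (_ ^+ _)%R; ring.
have bS2 j : (2 * b j <= b j.+1)%R.
  rewrite bS ler_pM2r// -[leLHS]expr1 ler_weXn2l//; lra.
pose h t : \bar R := (t `^ (alpha / n%:R) * p t * t^-1)%:E.
pose I j : set R := `]b j, b j.+1[%classic.
apply: (@le_trans _ _ (\int[m]_y \sum_(0 <= j <oo) F j y)).
  rewrite integral_mkcond; apply: ge0_le_integral_nomeas => y _.
    by rewrite patchE; case: ifPn => // _; rewrite mule_ge0// lee_fin invr_ge0 powR_ge0.
  rewrite patchE; case: ifPn => [/set_mem/= wys|_]; last exact: nneseries_ge0.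
  have [j jw] := dyadic_shell_above s0 wys.
  apply: le_trans (nneseries_ge_term j _) => //.
  rewrite /F patchE mem_set// muleC lee_wpmul2r// lee_fin /c.
  case/andP: jw => j1 j2.
  have wy0 : (0 < w y)%R by exact: lt_le_trans (sj j) j1.
  by rewrite lef_pV2 ?posrE ?powR_gt0// ge0_ler_powR// ?nnegrE ltW.
rewrite integral_nneseries//.
apply: (@le_trans _ _ (\sum_(0 <= j <oo)
    ((4 * (2 * M) ^+ n)%:E * \int[lebesgue_measure]_(t in I j) h t))).
  apply: lee_nneseries => [j _ _|j _]; first exact: integral_ge0.
  rewrite ge0_integralZl//; last 3 first.
  - apply/(measurable_restrictT _ _).1 => //; exact: measurable_funTS.
  - by move=> y _; rewrite patchE; case: ifPn.
  - by rewrite lee_fin.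
  rewrite -integral_mkcond.
  apply: le_trans (lee_wpmul2l _ (H j)) _; rewrite ?lee_fin//.
  pose v : R := (b j `^ (alpha / n%:R) * p (b j.+1) * (b j.+1)^-1)%R.
  have v0 : (0 <= v)%R by rewrite !mulr_ge0 ?powR_ge0 ?p0// invr_ge0 ltW.
  apply: (@le_trans _ _ ((4 * (2 * M) ^+ n)%:E * \int[lebesgue_measure]_(t in I j) (cst v%:E t))).
    rewrite integral_cst; last exact: measurable_itv.
    rewrite [X in _ <= _ * (_ * X)](_ : _ = (b j.+1 - b j)%:E); last first.
      rewrite [LHS]lebesgue_measure_itv/= lte_fin ifT// .
      by apply: lt_le_trans (bS2 j); rewrite ltr_pMl// ltr1n.
    rewrite -!EFinM lee_fin.
    have cb : (c j * b j.+1 <= (2 * M) ^+ n * b j `^ (alpha / n%:R))%R.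
      have -> : b j.+1 = ((2 * M) ^+ n * (s * 2 ^+ j) ^+ n)%R.
        by rewrite bS /b -!exprMn; congr (_ ^+ _)%R; ring.
      rewrite (powR_split (sj j)) mulrCA (mulrA (c j)) mulVf ?mul1r; last first.
        by rewrite gt_eqF// powR_gt0.
      rewrite ler_wpM2l ?exprn_ge0 ?mulr_ge0 ?(ltW M0)//.
      rewrite /b powR_root// ?mulr_ge0 ?exprn_ge0 ?(ltW M0) ?(ltW s0)//.
      have sj0 := ltW (sj j).
      apply: ge0_ler_powR; rewrite ?nnegrE ?(ltW alpha0)//.
        by rewrite mulr_ge0 ?(ltW M0).
      by rewrite ler_peMl.
    have half : (1 / 2 <= (b j.+1)^-1 * (b j.+1 - b j))%R.
      by rewrite (mulrC (b j.+1)^-1%R) ler_pdivlMr//; have := bS2 j; lra.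
    have P0 : (0 <= p (b j.+1))%R by exact: p0.
    rewrite /v; move: cb half P0. set P := p _; set Y := (_ `^ (alpha / _))%R.
    set X := ((2 * M) ^+ n)%R; set B := b j.+1; set e := (B^-1 * _)%R => cb half P0.
    have X0 : (0 <= X)%R by rewrite exprn_ge0// mulr_ge0// ltW.
    have Y0 : (0 <= Y)%R by exact: powR_ge0.
    apply: (@le_trans _ _ (2 * P * (X * Y))%R).
      have -> : (c j * (2 * B * P) = 2 * P * (c j * B))%R by ring.
      by rewrite ler_wpM2l// mulr_ge0.
    have -> : (4 * X * (Y * P * B^-1 * (B - b j)) = 4 * (X * Y) * P * e)%R.
      by rewrite /e; ring.
    have -> : (2 * P * (X * Y) = 4 * (X * Y) * P * (1 / 2))%R by field.
    by rewrite ler_wpM2l// !mulr_ge0.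
  apply: lee_wpmul2l; first by rewrite lee_fin ?mulr_ge0 ?exprn_ge0 ?mulr_ge0 ?(ltW M0).
  apply: ge0_le_integral_nomeas => t; rewrite /I /= in_itv/= => /andP[t1 t2].
    by rewrite lee_fin.
  have t0 : (0 < t)%R by exact: lt_trans (b0 j) t1.
  rewrite lee_fin /v ler_pM ?mulr_ge0 ?powR_ge0 ?p0 ?invr_ge0 ?(ltW (b0 _))//.
    rewrite ler_pM ?powR_ge0 ?p0//.
      by rewrite ge0_ler_powR ?nnegrE ?divr_ge0 ?(ltW alpha0)// ltW.
    by apply: pd => //; exact: ltW.
  by rewrite lef_pV2 ?posrE// ltW.
have bpos t j : I j t -> (0 < t)%R.
  by rewrite /I/= in_itv/= => /andP[t1 _]; exact: lt_trans t1.
have h0 t : (0 < t)%R -> 0 <= h t.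
  by move=> t0; rewrite lee_fin !mulr_ge0 ?powR_ge0 ?p0// invr_ge0 ltW.
rewrite nneseriesZl; last first.
  by move=> i _; apply: integral_ge0 => t /bpos; exact: h0.
have bmono i j : (i <= j)%N -> (b i <= b j)%R.
  elim: j => [|j IH]; first by rewrite leqn0 => /eqP ->.
  rewrite leq_eqVlt => /predU1P[->//|/IH]; have := bS2 j; have := b0 j; lra.
apply: lee_wpmul2l; first by rewrite lee_fin ?mulr_ge0 ?exprn_ge0 ?mulr_ge0 ?(ltW M0).
rewrite -ge0_integral_bigcup//.
- apply: ge0_subset_integral_nomeas => t.
    rewrite /= in_itv/= andbT => t1; apply: h0; apply: lt_trans t1.
    by rewrite exprn_gt0// mulr_gt0.
  move=> [j _]; rewrite /I /= !in_itv/= andbT => /andP[+ _]; apply: le_lt_trans.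
  by rewrite -[in leLHS](mulr1 s); exact: (bmono 0%N).
- by move=> k; exact: measurable_itv.
(* The power t^(-1) and the field inverse agree for t > 0, which holds on all the intervals; the
   power form makes measurability immediate. *)
- apply: (eq_measurable_fun (fun t => (t `^ (alpha / n%:R) * p t * t `^ (- 1))%:E)).
    move=> t /set_mem[j _ /bpos t0]; rewrite /h powR_inv1//; exact: ltW.
  apply: measurable_funTS; apply/measurable_EFinP.
  by apply: measurable_funM; [apply: measurable_funM => //|]; exact: measurable_powR.
- by move=> t [j _ /bpos]; exact: h0.
- apply/trivIsetP => i j _ _; wlog ij : i j / (i < j)%N.
    move=> W; rewrite neq_ltn => /orP[] ij; first by apply: W => //; rewrite neq_ltn ij.
    by rewrite setIC; apply: W => //; rewrite neq_ltn ij.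
  move=> _; apply/seteqP; split => // t []; rewrite /I /= !in_itv/= => /andP[_ t1] /andP[t2 _].
  by have := lt_trans t2 t1; rewrite ltNge bmono.
Qed.

End dyadic_sums.

(** * Orlicz functions and their inverses *)

Section orlicz.
Context {R : realType}.
Implicit Types (Phi : R -> R) (u v : R).

(* The cut-off [Num.max v 0] makes it monotone on all of R, hence measurable. *)
Definition orlicz_inverse Phi v : R :=
  xget 0 [set u | 0 <= u /\ Phi u = Num.max v 0].

Section theory.
Variable Phi : R -> R.
Hypothesis oPhi : orlicz_function Phi.

Lemma orlicz0 : Phi 0 = 0.
Proof. by case: oPhi. Qed.

Lemma orlicz_lt u v : 0 <= u -> u < v -> Phi u < Phi v.
Proof.
move=> u0 uv; case: oPhi => _ H _ _.
by apply: H; rewrite ?in_itv/= ?andbT// ltW// (le_lt_trans u0).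
Qed.

Lemma orlicz_le u v : 0 <= u -> u <= v -> Phi u <= Phi v.
Proof.
by move=> u0; rewrite le_eqVlt => /predU1P[->//|uv]; exact/ltW/orlicz_lt.
Qed.

Lemma orlicz_ltE u v : 0 <= u -> 0 <= v -> (Phi u < Phi v) = (u < v).
Proof.
move=> u0 v0; apply/idP/idP; last exact: orlicz_lt.
by rewrite !ltNge; apply: contra; exact: orlicz_le.
Qed.

Lemma orlicz_leE u v : 0 <= u -> 0 <= v -> (Phi u <= Phi v) = (u <= v).
Proof. by move=> u0 v0; rewrite !leNgt orlicz_ltE. Qed.

Lemma orlicz_ge0 u : 0 <= u -> 0 <= Phi u.
Proof. by move=> u0; rewrite -orlicz0; exact: orlicz_le. Qed.

Lemma orlicz_gt0 u : 0 < u -> 0 < Phi u.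
Proof. by move=> u0; rewrite -orlicz0; exact: orlicz_lt. Qed.

Lemma orlicz_convex (c u v : R) : 0 <= c <= 1 -> 0 <= u -> 0 <= v ->
  Phi (c * u + (1 - c) * v) <= c * Phi u + (1 - c) * Phi v.
Proof.
move=> /andP[c0 c1] u0 v0; case: oPhi => _ _ _ cv.
have := cv (Itv01 c0 c1) u v; rewrite !convRE/=; apply; rewrite inE/= in_itv/= ?u0 ?v0//.
Qed.

Lemma orlicz_scale (c u : R) : 0 <= c <= 1 -> 0 <= u -> Phi (c * u) <= c * Phi u.
Proof.
by move=> c01 u0; have := orlicz_convex c01 u0 (lexx 0); rewrite orlicz0 !mulr0 !addr0.
Qed.

Lemma orlicz_scale_ge (c u : R) : 1 <= c -> 0 <= u -> c * Phi u <= Phi (c * u).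
Proof.
move=> c1 u0; have c0 : 0 < c by lra.
have : Phi (c^-1 * (c * u)) <= c^-1 * Phi (c * u).
  apply: orlicz_scale; last by rewrite mulr_ge0// ltW.
  by rewrite invr_ge0 (ltW c0)/= invf_le1.
by rewrite mulrA mulVf ?gt_eqF// mul1r ler_pdivlMl.
Qed.

(** Convexity makes [Phi] unbounded: Phi(b) >= b Phi(1) for b >= 1. The choice of [b] makes this at
    least v, and the intermediate value theorem applies on [0, b]. *)
Lemma orlicz_surj v : 0 <= v -> exists2 u, 0 <= u & Phi u = v.
Proof.
move=> v0; pose b := Num.max 1 (v / Phi 1).
have b1 : 1 <= b by rewrite le_max lexx.
have vb : v <= Phi b.
  have := orlicz_scale_ge b1 ler01; rewrite mulr1; apply: le_trans.
  by rewrite -ler_pdivrMr ?orlicz_gt0// le_max lexx orbT.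
have b0 : 0 <= b by lra.
have cb : {within `[0, b], continuous Phi}.
  have sub : `[0, b] `<=` `[0, +oo[.
    by move=> t /=; rewrite !in_itv/= andbT => /andP[].
  by apply: (continuous_subspaceW sub); case: oPhi.
have [|u] := IVT b0 cb (v := v).
  by rewrite orlicz0 ge_min v0/= le_max vb orbT.
by rewrite in_itv/= => /andP[u0 _] <-; exists u.
Qed.

Local Notation phi := (orlicz_inverse Phi).

Lemma orlicz_inverse_spec v : 0 <= phi v /\ Phi (phi v) = Num.max v 0.
Proof.
have [u u0 uE] := @orlicz_surj (Num.max v 0) (ltac:(by rewrite le_max lexx orbT)).
by apply: (@xgetPex _ 0 [set u | 0 <= u /\ Phi u = Num.max v 0]); exists u.
Qed.

Lemma orlicz_inverse_ge0 v : 0 <= phi v.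
Proof. by have [] := orlicz_inverse_spec v. Qed.

Lemma orlicz_inverseK v : 0 <= v -> Phi (phi v) = v.
Proof. by move=> v0; have [_ ->] := orlicz_inverse_spec v; exact/max_idPl. Qed.

Lemma orlicz_inverse_le u v : 0 <= u -> 0 <= v -> (u <= phi v) = (Phi u <= v).
Proof.
by move=> u0 v0; rewrite -[in RHS](orlicz_inverseK v0) orlicz_leE ?orlicz_inverse_ge0.
Qed.

Lemma orlicz_inverse_lt u v : 0 <= u -> 0 <= v -> (phi v < u) = (v < Phi u).
Proof. by move=> u0 v0; rewrite !ltNge orlicz_inverse_le. Qed.

Lemma orlicz_inverse_homo : {homo phi : u v / u <= v}.
Proof.
move=> u v uv; rewrite -orlicz_leE ?orlicz_inverse_ge0//.
have [_ ->] := orlicz_inverse_spec u; have [_ ->] := orlicz_inverse_spec v.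
by rewrite ge_max !le_max lexx uv orbT.
Qed.

Lemma orlicz_inverse_gt0 v : 0 < v -> 0 < phi v.
Proof.
by move=> v0; rewrite -orlicz_ltE ?orlicz_inverse_ge0// orlicz0 orlicz_inverseK// ltW.
Qed.

(** The infimum runs over a strict inequality and is not attained: [phi v] is a lower bound, and
    phi(v) + e is admissible for each e > 0. This turns the extended-real inverses of the hypotheses
    into a real monotone function. *)
Lemma generalized_inverseE v : 0 <= v -> generalized_inverse Phi v = (phi v)%:E.
Proof.
move=> v0; apply/eqP; rewrite eq_le; apply/andP; split; last first.
  apply: le_ereal_inf_tmp => _ [u [u0 vu] <-].
  by rewrite lee_fin ltW// orlicz_inverse_lt.
apply/lee_addgt0Pr => e e0; apply: ereal_inf_lbound.
exists (phi v + e); last by rewrite EFinD.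
have h : 0 <= phi v + e by rewrite addr_ge0 ?orlicz_inverse_ge0 ?ltW.
by split => //; rewrite -orlicz_inverse_lt// ltrDl.
Qed.

Local Open Scope ereal_scope.

Lemma er_map_orlicz_ge0 (x : \bar R) : 0 <= x -> 0 <= er_map Phi x.
Proof. by case: x => [u| |]//=; rewrite !lee_fin; exact: orlicz_ge0. Qed.

Lemma er_map_orlicz_le (x y : \bar R) : 0 <= x -> x <= y ->
  er_map Phi x <= er_map Phi y.
Proof.
case: x y => [u| |] [v| |]//=; rewrite ?lee_fin ?leey//; exact: orlicz_le.
Qed.

Lemma er_map_orlicz_scale (c : R) (x : \bar R) : (0 < c <= 1)%R -> 0 <= x ->
  er_map Phi (c%:E * x) <= c%:E * er_map Phi x.
Proof.
case: x => [u| |]// /andP[c0 c1].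
  by rewrite lee_fin => u0; rewrite -EFinM /= lee_fin orlicz_scale// (ltW c0).
by move=> _; rewrite gt0_muley ?lte_fin//= gt0_muley ?lte_fin.
Qed.

(** Nothing is known about [Phi] on the negative reals, so it is first replaced by u -> Phi(max(u,
    0)), which is monotone on all of R and agrees with [Phi] on the values of g. *)
Lemma measurable_er_map_orlicz d (T : measurableType d) (D : set T) (g : T -> \bar R) :
  measurable D -> measurable_fun D g -> (forall x, 0 <= g x) ->
  measurable_fun D (fun x => er_map Phi (g x)).
Proof.
move=> mD mg g0; pose Phi' (u : R) : R := Phi (Num.max u 0)%R.
have mPhi' : measurable_fun setT Phi'.
  apply: nondecreasing_measurable => // u v uv; apply: orlicz_le.
    by rewrite le_max lexx orbT.
  by rewrite ge_max !le_max uv lexx orbT.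
apply: (eq_measurable_fun (er_map Phi' \o g)).
  move=> x _ /=; have := g0 x; case: (g x) => [u| |]//=; rewrite lee_fin => u0.
  by rewrite /Phi'; congr (Phi _)%:E; exact/max_idPl.
by apply: measurableT_comp => //; exact: measurable_er_map.
Qed.

End theory.
End orlicz.

(** * Growth of an Orlicz function whose complementary function is Delta_2 *)

Section growth.
Context {R : realType}.
Variable Phi : R -> R.
Hypothesis oPhi : orlicz_function Phi.

(** The witness is the left derivative at u, the supremum of the slopes of chords ending at u. It is
    finite because chords starting at u are steeper, and positive because the chord from 0 already
    is. *)
Lemma orlicz_subgradient (u : R) : 0 < u ->
  exists2 v, 0 < v & forall z, 0 <= z -> Phi u + v * (z - u) <= Phi z.
Proof.
move=> u0; pose S := [set (Phi u - Phi z) / (u - z) | z in [set z | 0 <= z < u]].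
have S0 : S ((Phi u - Phi 0) / (u - 0)) by exists 0 => //=; rewrite lexx.
have slopes (z t : R) : 0 <= z -> z < u -> u < t ->
    (Phi u - Phi z) / (u - z) <= (Phi t - Phi u) / (t - u).
  move=> z0 zu ut; have zt := lt_trans zu ut.
  have uz : 0 < u - z by lra.
  have tu : 0 < t - u by lra.
  have tz : 0 < t - z by lra.
  have c01 : 0 <= (u - z) / (t - z) <= 1.
    by rewrite divr_ge0 ?(ltW uz) ?(ltW tz)//= ler_pdivrMr// mul1r; lra.
  have := orlicz_convex oPhi c01 (ltW (lt_trans u0 ut)) z0.
  have -> : (u - z) / (t - z) * t + (1 - (u - z) / (t - z)) * z = u.
    by field; rewrite gt_eqF.
  move=> h; rewrite ler_pdivrMr// mulrAC ler_pdivlMr//.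
  rewrite -(ler_pM2l tz) in h; rewrite -subr_ge0 in h; rewrite -subr_ge0.
  apply: le_trans h _; rewrite le_eqVlt; apply/orP; left; apply/eqP.
  by field; rewrite gt_eqF.
have ubS : ubound S ((Phi (2 * u) - Phi u) / (2 * u - u)).
  by move=> _ [z /andP[z0 zu] <-]; apply: slopes => //; lra.
have hS : has_sup S by split; [eexists; exact: S0 | eexists; exact: ubS].
exists (sup S).
  apply: lt_le_trans (ub_le_sup hS.2 S0).
  by rewrite orlicz0// !subr0 divr_gt0// orlicz_gt0.
move=> z z0; have [zu|uz|->] := ltgtP z u; last by rewrite subrr mulr0 addr0.
  have uz : 0 < u - z by lra.
  have /(ub_le_sup hS.2) : S ((Phi u - Phi z) / (u - z)).
    by exists z => //=; rewrite z0.
  by rewrite ler_pdivrMr//; lra.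
have zu : 0 < z - u by lra.
have : sup S <= (Phi z - Phi u) / (z - u).
  by apply: ge_sup; [exists ((Phi u - Phi 0) / (u - 0))|move=> _ [t /andP[t0 tu] <-]; exact: slopes].
by rewrite ler_pdivlMr//; lra.
Qed.

(* With v a subgradient at u, equality holds in Young's inequality for (u, v);
   Young's inequality for (L u, 2 v) then transfers the Delta2 condition. *)
Lemma Delta2_complementary_growth : Delta2 (complementary Phi) ->
  exists2 L : R, 1 < L & forall u, 0 <= u -> 2 * L * Phi u <= Phi (L * u).
Proof.
(* Taking half of max(D, 4) gives D <= 2 L, so that 2 L is also a Delta_2 constant, and forces L >
   1. *)
move=> [finF [D D1 HD]]; pose L := Num.max D 4 / 2.
have L1 : 1 < L.
  by rewrite /L ltr_pdivlMr// mul1r lt_max; apply/orP; right; lra.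
exists L => // u; rewrite le_eqVlt => /predU1P[<-|u0].
  by rewrite mulr0 orlicz0// mulr0.
have [v v0 sub] := orlicz_subgradient u0.
have cfin w : 0 < w -> complementary Phi w \is a fin_num.
  by move=> /finF/andP[w1 w2]; rewrite ge0_fin_numE// ltW.
have cv : (complementary Phi v <= (u * v - Phi u)%:E)%E.
  apply: ge_ereal_sup => _ [z z0 <-]; rewrite lee_fin.
  by have := sub z (ltW z0); lra.
have c2v : ((L * u * (2 * v) - Phi (L * u))%:E <= complementary Phi (2 * v)%R)%E.
  by apply: ereal_sup_ubound; exists (L * u) => //=; rewrite mulr_gt0//; lra.
have v20 : 0 < 2 * v by lra.
have := HD v v0; move: cv c2v.
move: (finF v v0) (cfin v v0) (cfin _ v20).
case: (complementary Phi v) => // a; case: (complementary Phi (2 * v)) => // b.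
rewrite -!EFinM !lee_fin !lte_fin => /andP[a0 _] _ _ cv c2v Hab.
have DL : D <= 2 * L by rewrite /L mulrC divfK ?pnatr_eq0// le_max lexx.
have : D * a <= 2 * L * (u * v - Phi u).
  apply: le_trans (_ : 2 * L * a <= _); first by rewrite ler_pM2r.
  by rewrite ler_pM2l; lra.
by nra.
Qed.

End growth.

(** * A Jensen type inequality *)

Section orlicz_integral.
Context d (T : measurableType d) (R : realType) (m : {measure set T -> \bar R}).
Variable Phi : R -> R.
Hypothesis oPhi : orlicz_function Phi.
Local Open Scope ereal_scope.

(** With a = Phi^-1(P/M), one has u <= a + (a M / P) Phi(u) pointwise: this is clear for u <= a, and
    for u > a convexity gives Phi(u) >= (u/a) Phi(a). Integrating, each summand contributes at most
    a M. Only an upper bound of the measure of D is required, so cubes can stand in for balls. *)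
Lemma orlicz_integral_le (D : set T) (g : T -> \bar R) (M P : R) :
  measurable D -> measurable_fun D g -> (forall x, 0 <= g x) ->
  (0 < M)%R -> (0 < P)%R -> m D <= M%:E ->
  \int[m]_(x in D) er_map Phi (g x) <= P%:E ->
  \int[m]_(x in D) g x <= (2 * M * orlicz_inverse Phi (P / M))%:E.
Proof.
move=> mD mg g0 M0 P0 mDM IP.
have PM0 : (0 < P / M)%R by rewrite divr_gt0.
set a := orlicz_inverse Phi (P / M).
have a0 : (0 < a)%R by exact: orlicz_inverse_gt0.
have Pa : Phi a = (P / M)%R by rewrite orlicz_inverseK// ltW.
have mPg : measurable_fun D (fun x => er_map Phi (g x)).
  exact: measurable_er_map_orlicz.
have Pg0 x : 0 <= er_map Phi (g x) by exact: er_map_orlicz_ge0.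
apply: (@le_trans _ _ (\int[m]_(x in D) (a%:E + (a * M / P)%:E * er_map Phi (g x)))).
  apply: ge0_le_integral_nomeas => x _; first exact: g0.
  have k0 : (0 < a * M / P)%R by rewrite divr_gt0// mulr_gt0.
  have := g0 x; case: (g x) => [u| |]//=; last by rewrite gt0_muley ?lte_fin.
  rewrite -EFinM -EFinD !lee_fin => u0.
  have Pu0 := orlicz_ge0 oPhi u0.
  have [ua|au] := leP u a.
    by apply: le_trans ua _; rewrite lerDl mulr_ge0 ?(ltW k0).
  have ua1 : (1 <= u / a)%R by rewrite ler_pdivlMr// mul1r ltW.
  have := orlicz_scale_ge oPhi ua1 (ltW a0).
  rewrite divfK ?gt_eqF// Pa => h.
  have := ler_wpM2l (ltW k0) h.
  rewrite (_ : (a * M / P * (u / a * (P / M)))%R = u); last by field; rewrite !gt_eqF.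
  by move=> /le_trans; apply; rewrite lerDr ltW.
rewrite ge0_integralD//; last 3 first.
- by move=> x _; rewrite lee_fin ltW.
- by move=> x _; rewrite mule_ge0// lee_fin !mulr_ge0 ?invr_ge0 ?ltW.
- exact: measurable_funeM.
rewrite integral_cst// ge0_integralZl//; last first.
  by rewrite lee_fin !mulr_ge0 ?invr_ge0 ?ltW.
apply: (@le_trans _ _ (a%:E * M%:E + (a * M / P)%:E * P%:E)).
  by apply: leeD; apply: lee_wpmul2l => //; rewrite lee_fin ?mulr_ge0 ?invr_ge0 ?ltW.
rewrite -!EFinM -EFinD lee_fin le_eqVlt; apply/orP; left; apply/eqP.
by field; rewrite gt_eqF.
Qed.

End orlicz_integral.

(** * The Riesz kernel truncated to a ball *)

Section kernel.
Context {R : realType} {n : nat} (alpha : R).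
Hypotheses (alpha0 : 0 < alpha) (alphan : alpha < n%:R).
Implicit Types (x y : Rn R n) (q g : Rn R n -> \bar R).
Local Open Scope ereal_scope.

Definition riesz_kernel x y : R := ((edist x y `^ (n%:R - alpha))^-1)%R.

Lemma riesz_kernel_ge0 x y : (0 <= riesz_kernel x y)%R.
Proof. by rewrite invr_ge0 powR_ge0. Qed.

Lemma riesz_kernel_sym x y : riesz_kernel x y = riesz_kernel y x.
Proof. by rewrite /riesz_kernel edist_sym. Qed.

Lemma riesz_kernelE x y : riesz_kernel x y = (edist x y `^ (- (n%:R - alpha)))%R.
Proof. by rewrite powRN. Qed.

Lemma measurable_riesz_kernel :
  measurable_fun [set: Rn R n * Rn R n] (fun p => riesz_kernel p.1 p.2).
Proof.
rewrite (_ : (fun p => _) = fun p => (edist p.1 p.2 `^ (- (n%:R - alpha)))%R).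
  exact: (measurableT_comp (measurable_powR _) measurable_edist).
by apply/funext => p; rewrite riesz_kernelE.
Qed.

Lemma measurable_riesz_kernelr x : measurable_fun [set: Rn R n] (riesz_kernel x).
Proof. exact: (measurableT_comp measurable_riesz_kernel (measurable_pair1 x)). Qed.

Lemma measurable_mul_riesz_kernel q x : measurable_fun setT q ->
  measurable_fun setT (fun y => q y * (riesz_kernel x y)%:E).
Proof.
move=> mq; apply: emeasurable_funM; first exact: mq.
apply/measurable_EFinP; exact: measurable_riesz_kernelr.
Qed.

Definition riesz_near (s : R) q x : \bar R :=
  \int[leb]_(y in eball x s) (q y * (riesz_kernel x y)%:E).

Definition near_constant : R := (4 ^+ n / (2 `^ alpha - 1))%R.

Lemma near_constant_gt0 : (0 < near_constant)%R.
Proof. by rewrite divr_gt0 ?exprn_gt0// subr_gt0 powR2_gt1. Qed.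

(** Q bounds the averages of q over balls centered at x, up to the cube normalization. It will be a
    multiple of the maximal function, which gives Hedberg's inequality, or the value of a constant
    q. *)
Lemma riesz_near_le (s : R) q x (Q : \bar R) :
  measurable_fun setT q -> (forall y, 0 <= q y) -> (0 < s)%R -> 0 <= Q ->
  (forall r : R, (0 < r)%R ->
     \int[leb]_(y in eball x r) q y <= ((2 * r) ^+ n)%:E * Q) ->
  riesz_near s q x <= (near_constant * s `^ alpha)%:E * Q.
Proof.
move=> mq q0 s0 Q0 H.
apply: (near_sum_le alpha0 (edist_ge0 x) (measurable_edistr x) mq q0 s0 Q0) => //.
by rewrite subr_gt0.
Qed.

Lemma riesz_near_cst_le (s c : R) x : (0 < s)%R -> (0 <= c)%R ->
  riesz_near s (cst c%:E) x <= (near_constant * s `^ alpha * c)%:E.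
Proof.
move=> s0 c0; rewrite [leRHS]EFinM; apply: riesz_near_le => //.
move=> r r0; rewrite integral_cst; last exact: measurable_eball.
by rewrite muleC lee_wpmul2r ?lee_fin// leb_eball_le// ltW.
Qed.

(** Moving the truncation from the domain into the integrand makes the latter a jointly measurable
    function of (x, y), as Tonelli's theorem requires. *)
Lemma riesz_nearE s q x : riesz_near s q x =
  \int[leb]_y (q y * (riesz_kernel x y * (edist x y < s)%R%:R)%:E).
Proof.
rewrite /riesz_near integral_mkcond; apply: eq_integral => y _.
rewrite patchE; case: ifPn => [/set_mem|/negP yx].
  by rewrite /eball/= => ->; rewrite mulr1.
rewrite (_ : (edist x y < s)%R = false) ?mulr0 ?mule0//.
by apply/negP => h; apply: yx; rewrite inE.
Qed.

Lemma measurable_lt_edist2 s : measurable_fun [set: Rn R n * Rn R n]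
  (fun p => (edist p.1 p.2 < s)%R%:R%R : R).
Proof.
rewrite (_ : (fun p => _) = fun p : Rn R n * Rn R n => if (edist p.1 p.2 < s)%R then 1%R else 0%R).
  apply: measurable_fun_ifT => //; apply: measurable_fun_ltr => //.
  exact: measurable_edist.
by apply/funext => p; case: ifP.
Qed.

Lemma measurable_near_integrand s q : measurable_fun setT q ->
  measurable_fun [set: Rn R n * Rn R n]
    (fun p => q p.2 * (riesz_kernel p.1 p.2 * (edist p.1 p.2 < s)%R%:R)%:E).
Proof.
move=> mq; apply: emeasurable_funM.
  exact: (measurableT_comp mq measurable_snd).
apply/measurable_EFinP; apply: measurable_funM; first exact: measurable_riesz_kernel.
exact: measurable_lt_edist2.
Qed.

Lemma measurable_riesz_near s q : measurable_fun setT q -> (forall y, 0 <= q y) ->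
  measurable_fun setT (riesz_near s q).
Proof.
move=> mq q0; rewrite (_ : riesz_near s q = fubini_F leb
    (fun p => q p.2 * (riesz_kernel p.1 p.2 * (edist p.1 p.2 < s)%R%:R)%:E)).
  apply: measurable_fun_fubini_tonelli_F; first exact: measurable_near_integrand.
  by move=> p; rewrite mule_ge0// lee_fin mulr_ge0// riesz_kernel_ge0.
by apply/funext => x; rewrite riesz_nearE.
Qed.

(** After Tonelli, the symmetry of the kernel turns the inner integral into the truncated potential
    of the constant 1 at y, so the bound on L^infty yields the one on L^1 with the same constant. *)
Lemma integral_riesz_near_le s q : measurable_fun setT q -> (forall y, 0 <= q y) ->
  (0 < s)%R ->
  \int[leb]_x riesz_near s q x <=
  (near_constant * s `^ alpha)%:E * \int[leb]_y q y.
Proof.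
move=> mq q0 s0.
under eq_integral do rewrite riesz_nearE.
pose F (p : Rn R n * Rn R n) := q p.2 * (riesz_kernel p.1 p.2 * (edist p.1 p.2 < s)%R%:R)%:E.
rewrite (@fubini_tonelli _ _ _ _ _ leb leb F); last 2 first.
- exact: measurable_near_integrand.
- by move=> p; rewrite mule_ge0// lee_fin mulr_ge0// riesz_kernel_ge0.
have c0 : (0 <= near_constant * s `^ alpha)%R.
  by rewrite mulr_ge0 ?powR_ge0// ltW// near_constant_gt0.
rewrite -ge0_integralZl//.
apply: ge0_le_integral_nomeas => y _.
  by apply: integral_ge0 => x _; rewrite mule_ge0// lee_fin mulr_ge0// riesz_kernel_ge0.
rewrite /F/= ge0_integralZl; last 4 first.
- exact: measurableT.
- apply/measurable_EFinP; apply: measurable_funM.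
    exact: (measurableT_comp measurable_riesz_kernel (measurable_pair2 y)).
  exact: (measurableT_comp (measurable_lt_edist2 s) (measurable_pair2 y)).
- by move=> x _; rewrite lee_fin mulr_ge0// riesz_kernel_ge0.
- exact: q0.
rewrite muleC lee_wpmul2r//.
have := @riesz_near_cst_le s 1 y s0 ler01; rewrite mulr1 riesz_nearE.
apply: le_trans; rewrite le_eqVlt; apply/orP; left; apply/eqP; apply: eq_integral => x _.
by rewrite mul1e riesz_kernel_sym edist_sym.
Qed.

End kernel.

(** * Pointwise estimate of the potential on a ball *)

Section potential_estimate.
Context {R : realType} {n : nat} (alpha lambda mu : R) (Phi Psi : R -> R) (C1 C2 : R).
Hypotheses (n0 : (0 < n)%N) (alpha0 : 0 < alpha) (alphan : alpha < n%:R).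
Hypotheses (oPhi : orlicz_function Phi) (oPsi : orlicz_function Psi).
Hypotheses (lambda0 : 0 <= lambda) (lambda1 : lambda < 1).
Local Notation phi := (orlicz_inverse Phi).
Local Notation psi := (orlicz_inverse Psi).
Hypothesis H1 : forall u : R, 0 < u ->
      (\int[lebesgue_measure]_(t in `]u, +oo[)
          ((t `^ (alpha / n%:R))%:E *
           generalized_inverse Phi (t `^ (lambda - 1)) * (t^-1)%:E)
        <= C1%:E * generalized_inverse Psi (u `^ (mu - 1)))%E.
Hypothesis H2 : forall r u : R, 0 < u -> u < r ->
      ((u `^ (alpha / n%:R))%:E * generalized_inverse Phi (r `^ lambda / u)%R +
       \int[lebesgue_measure]_(t in `]u, r[)
          ((t `^ (alpha / n%:R))%:E *
           generalized_inverse Phi (r `^ lambda / t)%R * (t^-1)%:E)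
        <= C2%:E * generalized_inverse Psi (r `^ mu / u)%R)%E.

Variable g : Rn R n -> \bar R.
Hypotheses (mg : measurable_fun setT g) (g0 : forall y, (0 <= g y)%E).
Local Notation B r := (eball (@origin R n) r).
Hypothesis Hg : forall r : R, 0 < r ->
  (\int[leb]_(y in B r) er_map Phi (g y) <= (fine (leb (B r)) `^ lambda)%:E)%E.

Lemma leb_ball_powR_le (r M : R) (p : R) : 0 < r -> (2 * r) ^+ n <= M -> 0 <= p ->
  fine (leb (B r)) `^ p <= M `^ p.
Proof.
move=> r0 rM p0; have h : fine (leb (B r)) <= M.
  apply: le_trans rM; rewrite -lee_fin fineK ?leb_eball_fin//.
  by apply: leb_eball_le; exact: ltW.
by apply: ge0_ler_powR => //; rewrite nnegrE ?fine_ge0// (le_trans _ h)// fine_ge0.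
Qed.

Local Open Scope ereal_scope.

(** For |x| < r and |y| >= 2 r one has |x - y| >= |y| / 2, so the kernel may be centered at the
    origin at the cost of 2^(n - alpha) <= 2^n. The shells are then contained in balls B_s, the only
    ones on which the modular of g is controlled. The parameter 8 turns the inner radius 2 r into 16
    r, and 2^n 16^n = 32^n. *)
Lemma tail_le (r : R) x : (0 < r)%R -> B r x ->
  \int[leb]_(y in [set y | (2 * r <= edist (@origin R n) y)%R])
     (g y * (riesz_kernel alpha x y)%:E) <=
  (4 * 32 ^+ n * (C1 * psi (((16 * r) ^+ n) `^ (mu - 1))))%:E.
Proof.
move=> r0 Bx.
pose w := edist (@origin R n).
have beta0 : (0 < n%:R - alpha)%R by rewrite subr_gt0.
apply: (@le_trans _ _ ((2 ^+ n)%:E * \int[leb]_(y in [set y | (2 * r <= w y)%R])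
     (g y * (((w y) `^ (n%:R - alpha))^-1)%:E))).
  rewrite -ge0_integralZl; last 4 first.
  - exact: measurable_edist_ge.
  - apply: measurable_funTS; exact: measurable_mul_riesz_kernel.
  - by move=> y _; rewrite mule_ge0// lee_fin invr_ge0 powR_ge0.
  - by rewrite lee_fin exprn_ge0.
  apply: ge0_le_integral_nomeas => y.
    by move=> _; rewrite mule_ge0// lee_fin riesz_kernel_ge0.
  rewrite /= -/(w y) => yr; rewrite muleCA lee_wpmul2l// -EFinM lee_fin.
  have wy0 : (0 < w y)%R by apply: lt_le_trans yr; rewrite mulr_gt0.
  have dxy : (w y / 2 <= edist x y)%R.
    have := edist_triangle x (@origin R n) y; move: Bx; rewrite /eball /= -/(w y) => Bx.
    by rewrite ler_pdivrMr//; lra.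
  apply: (@le_trans _ _ (((w y / 2) `^ (n%:R - alpha))^-1)%R).
    rewrite lef_pV2 ?posrE ?powR_gt0// ?divr_gt0//; last first.
      by apply: lt_le_trans dxy; rewrite divr_gt0.
    apply: ge0_ler_powR; rewrite ?nnegrE ?(ltW beta0) ?edist_ge0//.
    by rewrite divr_ge0// ltW.
  have -> : (((w y / 2) `^ (n%:R - alpha))^-1 =
    2 `^ (n%:R - alpha) * ((w y) `^ (n%:R - alpha))^-1)%R.
    rewrite powRM ?(ltW wy0) ?invr_ge0// invfM mulrC; congr (_ * _)%R.
    by rewrite -powR_inv1// -powRrM -powRN; congr (_ `^ _)%R; ring.
  rewrite ler_wpM2r ?invr_ge0 ?powR_ge0// -powR_mulrn// ler_powR ?ler1n//.
  by rewrite gerBl ltW.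
pose p t := phi (t `^ (lambda - 1)).
have lam1 t u : (0 < t)%R -> (t <= u)%R -> (u `^ (lambda - 1) <= t `^ (lambda - 1))%R.
  move=> t0 tu; rewrite -(opprB 1%R lambda) !powRN.
  have u0 : (0 < u)%R by exact: lt_le_trans tu.
  rewrite lef_pV2 ?posrE ?powR_gt0//; apply: ge0_ler_powR; rewrite ?nnegrE ?(ltW t0) ?(ltW u0)//.
  by rewrite subr_ge0 ltW.
have := @shell_sum_le _ _ R leb n alpha w alpha0 (measurable_edistr _)
  g p (2 * r) 8 mg g0.
move=> /(_ (ltac:(by rewrite mulr_gt0)) (ltac:(by rewrite ler1n)) n0 beta0).
move=> /(_ (fun t _ => orlicz_inverse_ge0 oPhi _)).
move=> /(_ (fun t u t0 tu => orlicz_inverse_homo oPhi (lam1 t u t0 tu))).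
have mp : measurable_fun setT p.
  apply: measurableT_comp; last exact: measurable_powR.
  by apply: nondecreasing_measurable => //; exact: orlicz_inverse_homo.
move=> /(_ mp) /=.
have Hshell : forall j : nat,
    \int[leb]_(y in [set y | (2 * r * 2 ^+ j <= w y < 2 * r * 2 ^+ j.+1)%R]) g y <=
    (2 * (8 * (2 * r * 2 ^+ j.+1)) ^+ n * p ((8 * (2 * r * 2 ^+ j.+1)) ^+ n))%:E.
  move=> j; set s := (2 * r * 2 ^+ j.+1)%R; set M := ((8 * s) ^+ n)%R.
  have s0 : (0 < s)%R by rewrite !mulr_gt0// exprn_gt0.
  have M0 : (0 < M)%R by rewrite exprn_gt0// mulr_gt0.
  have sM : ((2 * s) ^+ n <= M)%R.
    by rewrite lerXn2r ?nnegrE ?mulr_ge0 ?(ltW s0)//; lra.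
  apply: (@le_trans _ _ (\int[leb]_(y in B s) g y)).
    apply: ge0_subset_integral_nomeas => // y /=; by case/andP.
  (* The Jensen inequality will be used with modular bound M^lambda and measure bound M, whose
     quotient is the argument of [phi] in [p]. *)
  rewrite /p (_ : M `^ (lambda - 1) = M `^ lambda / M)%R; last first.
    by rewrite powRD ?powR_inv1 ?(ltW M0)// (gt_eqF M0) implybT.
  apply: orlicz_integral_le => //.
  - exact: measurable_eball.
  - exact: measurable_funTS.
  - exact: powR_gt0.
  - by apply: le_trans (leb_eball_le _ (ltW s0)) _; rewrite lee_fin.
  - by apply: le_trans (Hg s0) _; rewrite lee_fin leb_ball_powR_le.
move=> /(_ Hshell) shell.
apply: (@le_trans _ _ ((2 ^+ n)%:E * ((4 * (2 * 8) ^+ n)%:E * (C1%:E * (psi (((16 * r) ^+ n) `^ (mu - 1)))%:E)))).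
  apply: lee_wpmul2l; first by rewrite lee_fin exprn_ge0.
  apply: le_trans shell _.
  apply: lee_wpmul2l; first by rewrite lee_fin mulr_ge0// exprn_ge0.
  have R0 : (0 < (16 * r) ^+ n)%R by rewrite exprn_gt0// mulr_gt0.
  have := H1 R0; rewrite (generalized_inverseE oPsi) ?powR_ge0//.
  apply: le_trans.
  rewrite (_ : 8 * (2 * r) = 16 * r)%R; last by ring.
  rewrite le_eqVlt; apply/orP; left; apply/eqP; apply: eq_integral => t _.
  by rewrite (generalized_inverseE oPhi) ?powR_ge0// -!EFinM.
rewrite -!EFinM lee_fin le_eqVlt; apply/orP; left; apply/eqP.
rewrite (_ : 32 = 2 * (2 * 8) :> R)%R; last by ring.
rewrite [in RHS]exprMn; ring.
Qed.

Let inner (r : R) : Rn R n -> \bar R := g \_ (B (2 * r)%R).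

Lemma inner_ge0 r y : 0 <= inner r y.
Proof. by rewrite /inner patchE; case: ifPn. Qed.

Lemma measurable_inner r : measurable_fun setT (inner r).
Proof.
apply/(measurable_restrictT _ _).1; first exact: measurable_eball.
exact: measurable_funTS.
Qed.

Lemma inner_modular_le r (D : set (Rn R n)) : (0 < r)%R ->
  \int[leb]_(y in D) er_map Phi (inner r y) <= (((16 * r) ^+ n) `^ lambda)%:E.
Proof.
move=> r0; apply: (@le_trans _ _ (\int[leb]_(y in B (2 * r)%R) er_map Phi (g y))).
  rewrite integral_mkcond [leRHS]integral_mkcond.
  apply: ge0_le_integral_nomeas => y _; rewrite /inner !patchE.
    by case: ifPn => // _; apply: er_map_orlicz_ge0 => //; case: ifPn.
  by case: ifPn => // _; case: ifPn => //= _; rewrite ?orlicz0// er_map_orlicz_ge0.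
have r20 : (0 < 2 * r)%R by rewrite mulr_gt0.
apply: le_trans (Hg r20) _; rewrite lee_fin leb_ball_powR_le//.
by rewrite lerXn2r ?nnegrE ?mulr_ge0 ?(ltW r0)//; lra.
Qed.

(** Here the shells are centered at x, where only the modular of the truncation to B_2r is
    controlled, by R^lambda whatever the shell. This is why the second hypothesis carries r^lambda /
    t rather than t^(lambda - 1). *)
Lemma middle_le (r s : R) x : (0 < r)%R -> B r x -> (0 < s)%R ->
  ((2 * s) ^+ n < (16 * r) ^+ n)%R ->
  \int[leb]_(y in [set y | (s <= edist x y)%R])
     (inner r y * (riesz_kernel alpha x y)%:E) <=
  (4 * 4 ^+ n * (C2 * psi (((16 * r) ^+ n) `^ mu / (2 * s) ^+ n)))%:E.
Proof.
move=> r0 Bx s0 sr.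
pose Rr := ((16 * r) ^+ n)%R; pose w := edist x.
have beta0 : (0 < n%:R - alpha)%R by rewrite subr_gt0.
have Rr0 : (0 < Rr)%R by rewrite exprn_gt0// mulr_gt0.
have u0 : (0 < (2 * s) ^+ n)%R by rewrite exprn_gt0// mulr_gt0.
(* Cutting [p] off at [Rr] reduces the integral over a half-line to the interval of the second
   hypothesis; [p] remains nonincreasing because [phi] is nonnegative. *)
pose p t := (if t < Rr then phi (Rr `^ lambda * t `^ (- 1)) else 0)%R.
have p0 t : (0 < t -> 0 <= p t)%R.
  by rewrite /p; case: ifP => // _ _; exact: orlicz_inverse_ge0.
have pd (t u : R) : (0 < t)%R -> (t <= u)%R -> (p u <= p t)%R.
  move=> t0 tu; have v0 : (0 < u)%R by exact: lt_le_trans tu.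
  rewrite /p; case: ifPn => uR; last by exact: p0.
  rewrite (le_lt_trans tu uR); apply: orlicz_inverse_homo => //.
  by rewrite ler_wpM2l ?powR_ge0// (powR_inv1 (ltW t0)) (powR_inv1 (ltW v0)) lef_pV2.
have mp : measurable_fun setT p.
  apply: measurable_fun_ifT => //; first exact: measurable_fun_ltr.
  apply: measurableT_comp.
    by apply: nondecreasing_measurable => //; exact: orlicz_inverse_homo.
  by apply: measurable_funM => //; exact: measurable_powR.
have Hshell : forall j : nat,
    \int[leb]_(y in [set y | (s * 2 ^+ j <= w y < s * 2 ^+ j.+1)%R]) inner r y <=
    (2 * (2 * (s * 2 ^+ j.+1)) ^+ n * p ((2 * (s * 2 ^+ j.+1)) ^+ n))%:E.
  move=> j; set s' := (s * 2 ^+ j.+1)%R; set M := ((2 * s') ^+ n)%R.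
  have s'0 : (0 < s')%R by rewrite mulr_gt0// exprn_gt0.
  have M0 : (0 < M)%R by rewrite exprn_gt0// mulr_gt0.
  (* A shell at distance at least 3 r from x misses B_2r. Any other shell has s 2^j < 3 r, hence 2 s
     2^(j+1) < 12 r < 16 r, so its volume variable is below the cut-off. *)
  have [far|nfar] := leP (3 * r)%R (s * 2 ^+ j)%R.
    rewrite (_ : integral _ _ _ = 0); first by rewrite lee_fin !mulr_ge0 ?p0// ltW.
    apply: integral0_eq => y /= /andP[yj _]; rewrite /inner patchE ifF//.
    apply/negP => /set_mem; rewrite /eball/= => yr.
    have := edist_triangle (@origin R n) x y; rewrite (edist_sym x origin) -/(w y).
    by move: Bx; rewrite /eball/= => Bx; lra.
  have MR : (M < Rr)%R.
    have h : (2 * s' < 16 * r)%R by rewrite /s' exprS; lra.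
    by rewrite ltrXn2r -?lt0n// mulr_ge0// ltW.
  apply: (@le_trans _ _ (\int[leb]_(y in eball x s') inner r y)).
    apply: ge0_subset_integral_nomeas => [y _|y /= /andP[]//]; exact: inner_ge0.
  rewrite /p MR powR_inv1 ?(ltW M0)//.
  apply: orlicz_integral_le => //.
  - exact: measurable_eball.
  - by apply: measurable_funTS; exact: measurable_inner.
  - exact: inner_ge0.
  - exact: powR_gt0.
  - by apply: leb_eball_le; exact: ltW.
  - exact: inner_modular_le.
have := @shell_sum_le _ _ R leb n alpha w alpha0 (measurable_edistr _)
  (inner r) p s 2 (measurable_inner r) (inner_ge0 r) s0 (ltac:(by rewrite ler1n)) n0 beta0 p0 pd mp Hshell.
move=> /le_trans; apply.
rewrite (_ : (2 * 2 = 4 :> R)%R); last by ring.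
rewrite [leRHS]EFinM; apply: lee_wpmul2l; first by rewrite lee_fin mulr_ge0// exprn_ge0.
have := H2 u0 sr; rewrite (generalized_inverseE oPsi) ?divr_ge0 ?powR_ge0 ?(ltW u0)//.
apply: le_trans; apply: le_trans (leeDr _ _); last first.
  by rewrite (generalized_inverseE oPhi) ?divr_ge0 ?powR_ge0 ?(ltW u0)// mule_ge0// lee_fin ?powR_ge0 ?orlicz_inverse_ge0.
rewrite integral_mkcond [leRHS]integral_mkcond.
apply: ge0_le_integral_nomeas => t _; rewrite !patchE.
  case: ifPn => // /set_mem/=; rewrite in_itv/= andbT => ut.
  by rewrite lee_fin !mulr_ge0 ?powR_ge0 ?p0 ?invr_ge0 ?(ltW (lt_trans u0 ut))// (lt_trans u0 ut).
case: ifPn => [/set_mem/=|_]; last first.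
  case: ifPn => // /set_mem/=; rewrite in_itv/= => /andP[ut tr].
  have t0 := lt_trans u0 ut.
  by rewrite (generalized_inverseE oPhi) ?divr_ge0 ?powR_ge0 ?(ltW t0)// !mule_ge0 ?lee_fin ?powR_ge0 ?orlicz_inverse_ge0// invr_ge0 ltW.
rewrite in_itv/= andbT => ut; have t0 := lt_trans u0 ut.
have [tR|Rt] := ltP t Rr.
  rewrite mem_set/=; last by rewrite in_itv/= ut.
  by rewrite (generalized_inverseE oPhi) ?divr_ge0 ?powR_ge0 ?(ltW t0)// /p tR powR_inv1 ?(ltW t0)// -!EFinM.
have -> : p t = 0%R by rewrite /p ifF//; apply/negbTE; rewrite -leNgt.
rewrite ifF; first by rewrite mulr0 mul0r.
by apply/negP => /set_mem/=; rewrite in_itv/= => /andP[_]; rewrite ltNge -/Rr Rt.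
Qed.

Lemma riesz_inner_le r s x : (0 <= C1)%R -> (0 < r)%R -> B r x -> (0 < s)%R ->
  ((2 * s) ^+ n < (16 * r) ^+ n)%R ->
  riesz alpha g x <= riesz_near alpha s (inner r) x +
    ((4 * 4 ^+ n * C2 + 4 * 32 ^+ n * C1) *
      psi (((16 * r) ^+ n) `^ mu / (2 * s) ^+ n))%:E.
Proof.
move=> C10 r0 Bx s0 sr.
have u0 : (0 < (2 * s) ^+ n)%R by rewrite exprn_gt0// mulr_gt0.
have R0 := lt_trans u0 sr.
have gk0 y : 0 <= g y * (riesz_kernel alpha x y)%:E.
  by rewrite mule_ge0// lee_fin riesz_kernel_ge0.
have ik0 y : 0 <= inner r y * (riesz_kernel alpha x y)%:E.
  by rewrite mule_ge0 ?inner_ge0// lee_fin riesz_kernel_ge0.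
pose I := [set y : Rn R n | (s <= edist x y)%R].
pose O := [set y : Rn R n | (2 * r <= edist (@origin R n) y)%R].
pose f1 := (fun y => inner r y * (riesz_kernel alpha x y)%:E) \_ (eball x s).
pose f2 := (fun y => inner r y * (riesz_kernel alpha x y)%:E) \_ I.
pose f3 := (fun y => g y * (riesz_kernel alpha x y)%:E) \_ O.
have f10 y : 0 <= f1 y by rewrite /f1 patchE; case: ifPn.
have f20 y : 0 <= f2 y by rewrite /f2 patchE; case: ifPn.
have f30 y : 0 <= f3 y by rewrite /f3 patchE; case: ifPn.
have mf1 : measurable_fun setT f1.
  apply/(measurable_restrictT _ _).1; first exact: measurable_eball.
  apply: measurable_funTS; apply: measurable_mul_riesz_kernel; exact: measurable_inner.
have mf2 : measurable_fun setT f2.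
  apply/(measurable_restrictT _ _).1; first exact: measurable_edist_ge.
  apply: measurable_funTS; apply: measurable_mul_riesz_kernel; exact: measurable_inner.
have mf3 : measurable_fun setT f3.
  apply/(measurable_restrictT _ _).1; first exact: measurable_edist_ge.
  apply: measurable_funTS; exact: measurable_mul_riesz_kernel.
apply: (@le_trans _ _ (\int[leb]_y ((f1 y + f2 y) + f3 y))).
  apply: ge0_le_integral_nomeas => y _; first exact: gk0.
  have [yO|yO] := leP (2 * r)%R (edist (@origin R n) y).
    by rewrite [f3 y]patchE mem_set// leeDr// adde_ge0.
  have gi : g y = inner r y by rewrite /inner patchE mem_set.
  rewrite -/(riesz_kernel alpha x y) gi; apply: le_trans (leeDl _ (f30 y)).
  have [yI|yI] := leP s (edist x y).
    by rewrite [f2 y]patchE mem_set// leeDr.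
  by rewrite [f1 y]patchE mem_set// leeDl.
rewrite ge0_integralD; last 5 first.
- exact: measurableT.
- by move=> y _; rewrite adde_ge0.
- exact: emeasurable_funD.
- by move=> y _.
- exact: mf3.
rewrite ge0_integralD; last 5 first.
- exact: measurableT.
- by move=> y _.
- exact: mf1.
- by move=> y _.
- exact: mf2.
rewrite /f1 /f2 /f3 -!integral_mkcond mulrDl EFinD.
have h2 := middle_le r0 Bx s0 sr.
have h3 : \int[leb]_(y in O) (g y * (riesz_kernel alpha x y)%:E) <=
    (4 * 32 ^+ n * C1 * psi (((16 * r) ^+ n) `^ mu / (2 * s) ^+ n))%:E.
  apply: le_trans (tail_le r0 Bx) _; rewrite lee_fin -!mulrA.
  (* The tail is estimated at volume R, and (2 s)^n < R makes R^(mu - 1) at most R^mu / (2 s)^n. *)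
  rewrite !ler_wpM2l ?exprn_ge0//; apply: orlicz_inverse_homo => //.
  rewrite powRD ?powR_inv1 ?(ltW R0)//; last by rewrite (gt_eqF R0) implybT.
  by rewrite ler_wpM2l ?powR_ge0// lef_pV2 ?posrE// ltW.
rewrite -addeA; apply: leeD => //; apply: leeD => //.
by rewrite -mulrA.
Qed.

Lemma first_term_le r s : (0 < r)%R -> (0 < s)%R ->
  ((2 * s) ^+ n < (16 * r) ^+ n)%R ->
  (s `^ alpha * phi (((16 * r) ^+ n) `^ lambda / (2 * s) ^+ n) <=
   C2 * psi (((16 * r) ^+ n) `^ mu / (2 * s) ^+ n))%R.
Proof.
move=> r0 s0 sr.
have u0 : (0 < (2 * s) ^+ n)%R by rewrite exprn_gt0// mulr_gt0.
rewrite -lee_fin; have := H2 u0 sr.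
rewrite (generalized_inverseE oPsi) ?divr_ge0 ?powR_ge0 ?(ltW u0)//.
rewrite (generalized_inverseE oPhi) ?divr_ge0 ?powR_ge0 ?(ltW u0)//.
rewrite -EFinM; apply: le_trans.
apply: le_trans (leeDl _ _); last first.
  apply: integral_ge0 => t /=; rewrite in_itv/= => /andP[/(lt_trans u0) t0 _].
  rewrite (generalized_inverseE oPhi) ?divr_ge0 ?powR_ge0 ?(ltW t0)//.
  by rewrite !mule_ge0 ?lee_fin ?powR_ge0 ?orlicz_inverse_ge0// invr_ge0 ltW.
rewrite lee_fin ler_wpM2r ?orlicz_inverse_ge0// powR_root ?mulr_ge0 ?(ltW s0)//.
apply: ge0_ler_powR; rewrite ?nnegrE ?(ltW alpha0) ?mulr_ge0 ?(ltW s0)//.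
by lra.
Qed.

End potential_estimate.

(** * Geometric sums over heights *)

Section doubling_sums.
Context {R : realType}.

(** Halved terms of a sequence that at least doubles sum to at most the last term. Hence the last
    selected index controls all the preceding ones, selected or not. *)
Lemma doubling_sum_le (q : nat -> R) (c : nat -> bool) (X : R) N :
  (forall k, 0 <= q k) -> (forall k, 2 * q k <= q k.+1) ->
  (forall k, c k -> q k <= X) -> 0 <= X ->
  \sum_(0 <= k < N) q k / 2 * (c k)%:R <= X.
Proof.
move=> q0 q2 cX X0.
have full K : \sum_(0 <= k < K.+1) q k / 2 <= q K.
  elim: K => [|K IH]; first by rewrite big_nat1; have := q0 0%N; lra.
  by rewrite big_nat_recr//=; have := q2 K; lra.
elim: N => [|N IH]; first by rewrite big_nil.
case cN : (c N); last by rewrite big_nat_recr//= cN mulr0 addr0.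
apply: le_trans (cX N cN); apply: le_trans (full N); apply: ler_sum => k _.
by case: (c k); rewrite ?mulr1// mulr0 divr_ge0.
Qed.

(** A discrete layer-cake bound. If the right side had a value r < x, let e_(j+1) be the first value
    exceeding r; it is not e_0. Then e_j <= r < x, so the sum contains e_(j+1), which is greater
    than r. *)
Lemma staircase_le (e : nat -> R) (x : \bar R) :
  (forall k, 0 <= e k) -> (forall r : R, exists k, r < e k) ->
  (x <= (e 0%N)%:E +
     \sum_(0 <= k <oo) (e k.+1)%:E * ((e k)%:E < x)%E%:R%:E)%E.
Proof.
move=> e0 eoo; rewrite leNgt; apply/negP.
set S := (X in (_ + X)%E).
have u0 k : (0 <= (e k.+1)%:E * ((e k)%:E < x)%E%:R%:E)%E by rewrite mule_ge0 ?lee_fin.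
have S0 : (0 <= S)%E by exact: nneseries_ge0.
case SE : (_ + S)%E => [r| |] h; last 2 first.
- by rewrite ltNge leey in h.
- by have := adde_ge0 (e0 0%N : (0 <= (e 0%N)%:E)%E) S0; rewrite SE leeNy_eq.
have er : e 0%N <= r by rewrite -lee_fin -SE leeDl.
case: (ex_minnP (eoo r)) => -[|j] rj min; first by rewrite ltNge er in rj.
have ejr : e j <= r by rewrite leNgt; apply/negP => /min; rewrite ltnn.
have : ((e j.+1)%:E <= r%:E)%E.
  rewrite -SE; apply: le_trans (leeDr _ _); last by rewrite lee_fin.
  apply: le_trans (nneseries_ge_term j u0).
  by rewrite (le_lt_trans _ h) ?lee_fin// mulr1.
by rewrite lee_fin leNgt rj.
Qed.

End doubling_sums.

(** * Modular estimates on one ball; [Rl] and [Rm] stand for R^lambda and R^mu *)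

Section ball_modular.
Context {R : realType} {n : nat} (alpha : R) (Phi Psi : R -> R).
Hypotheses (n0 : (0 < n)%N) (alpha0 : 0 < alpha) (alphan : alpha < n%:R).
Hypotheses (oPhi : orlicz_function Phi) (oPsi : orlicz_function Psi).
Local Notation phi := (orlicz_inverse Phi).
Local Notation psi := (orlicz_inverse Psi).
Local Notation CN := (near_constant (n := n) alpha).
Variables (D : set (Rn R n)) (F g : Rn R n -> \bar R) (Rl Rm Rr A0 C2 : R).
Hypotheses (mD : measurable D) (mF : measurable_fun setT F) (F0 : forall x, (0 <= F x)%E).
Hypotheses (mg : measurable_fun setT g) (g0 : forall x, (0 <= g x)%E).
Hypotheses (Rr0 : 0 < Rr) (Rl0 : 0 < Rl) (Rm0 : 0 < Rm) (A00 : 0 < A0) (C20 : 0 < C2).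
Hypothesis DR : (leb D <= Rr%:E)%E.
Hypothesis modg : (\int[leb]_y er_map Phi (g y) <= Rl%:E)%E.
Hypothesis HF : forall x s, D x -> 0 < s -> (2 * s) ^+ n < Rr ->
  (F x <= riesz_near alpha s g x + (A0 * psi (Rm / (2 * s) ^+ n))%:E)%E.
Hypothesis Hs : forall s, 0 < s -> (2 * s) ^+ n < Rr ->
  s `^ alpha * phi (Rl / (2 * s) ^+ n) <= C2 * psi (Rm / (2 * s) ^+ n).

Lemma exists_radius (u : R) : 0 < u -> exists2 s, 0 < s & (2 * s) ^+ n = u.
Proof.
move=> u0; exists (u `^ (n%:R^-1) / 2); first by rewrite divr_gt0// powR_gt0.
rewrite mulrC divfK ?pnatr_eq0// -powR_mulrn ?powR_ge0// -powRrM mulVf ?powRr1 ?(ltW u0)//.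
by rewrite pnatr_eq0 -lt0n.
Qed.

Local Open Scope ereal_scope.

(** Write tau and sigma for the two inverses at u and split g at height L tau. The truncated
    potential of the bounded part is at most A sigma, because s^alpha tau <= C2 sigma. Where F > 4 A
    sigma, the high part therefore has truncated potential above 2 A sigma, and Markov's inequality
    with the L^1 bound concludes. Splitting at L tau rather than tau is what later aligns
    consecutive heights. *)
Lemma superlevel_le (L A u : R) : (1 <= L)%R -> (A0 <= A)%R -> (L * CN * C2 <= A)%R ->
  (0 < u)%R -> (u < Rr)%R ->
  leb (D `&` [set x | (4 * A * psi (Rm / u))%:E < F x]) <=
  ((2 * L * phi (Rl / u))^-1)%:E *
    \int[leb]_(y in [set y | (L * phi (Rl / u))%:E < g y]) g y.
Proof.
move=> L1 A0A CA u0 uR; have [s s0 su] := exists_radius u0.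
have tau0 : (0 < phi (Rl / u))%R by apply: orlicz_inverse_gt0 => //; rewrite divr_gt0.
have psi0 : (0 < psi (Rm / u))%R by apply: orlicz_inverse_gt0 => //; rewrite divr_gt0.
have L0 : (0 < L)%R by lra.
have CN0 : (0 < CN)%R by exact: near_constant_gt0.
have A_gt0 : (0 < A)%R by exact: lt_le_trans A00 A0A.
have uR' : ((2 * s) ^+ n < Rr)%R by rewrite su.
have := Hs s0 uR'; rewrite su => hs.
set tau := phi _ in tau0 hs *; set sg := psi _ in psi0 hs *.
set E := [set y | (L * tau)%:E < g y]; pose q := g \_ E.
have mE : measurable E.
  rewrite -[X in measurable X]setTI; exact: emeasurable_fun_o_infty.
have mq : measurable_fun setT q.
  by apply/(measurable_restrictT _ _).1 => //; exact: measurable_funTS.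
have q0 y : 0 <= q y by rewrite /q patchE; case: ifPn.
have nearq : forall x, riesz_near alpha s g x <= (A * sg)%:E + riesz_near alpha s q x.
  move=> x.
  have Ltau0 : (0 <= L * tau)%R by rewrite mulr_ge0// ltW.
  apply: (@le_trans _ _ (riesz_near alpha s (cst (L * tau)%:E) x + riesz_near alpha s q x)).
    rewrite /riesz_near -ge0_integralD; last 5 first.
    - exact: measurable_eball.
    - by move=> y _; rewrite mule_ge0// lee_fin riesz_kernel_ge0.
    - apply: measurable_funTS; apply: measurable_mul_riesz_kernel; exact: measurable_cst.
    - by move=> y _; rewrite mule_ge0// lee_fin riesz_kernel_ge0.
    - apply: measurable_funTS; exact: measurable_mul_riesz_kernel.
    apply: ge0_le_integral_nomeas => y _.
      by rewrite mule_ge0// lee_fin riesz_kernel_ge0.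
    rewrite -ge0_muleDl//; apply: lee_wpmul2r; first by rewrite lee_fin riesz_kernel_ge0.
    rewrite /q patchE; case: ifPn => [_|]; first by rewrite leeDr.
    by rewrite notin_setE/= => /negP; rewrite -leNgt adde0.
  rewrite leeD2r//; apply: le_trans (riesz_near_cst_le alpha0 alphan x s0 Ltau0) _.
  rewrite lee_fin; apply: (@le_trans _ _ (L * CN * C2 * sg)%R); last by rewrite ler_wpM2r// ltW.
  have -> : (CN * s `^ alpha * (L * tau) = (L * CN) * (s `^ alpha * tau))%R by ring.
  by rewrite -[leRHS]mulrA ler_wpM2l// mulr_ge0// ltW.
have sub : D `&` [set x | (4 * A * sg)%:E < F x] `<=`
    setT `&` [set x | (2 * A * sg)%:E < riesz_near alpha s q x].
  move=> x [Dx /= Fx]; split => //=.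
  have := lt_le_trans Fx (HF Dx s0 uR'); rewrite su -/sg => h.
  have : (4 * A * sg)%:E < (2 * A * sg)%:E + riesz_near alpha s q x.
    apply: (lt_le_trans h); apply: (@le_trans _ _ ((A * sg)%:E + riesz_near alpha s q x + (A * sg)%:E)).
      by apply: leeD => //; rewrite lee_fin ler_wpM2r// ltW.
    rewrite addeAC -EFinD leeD2r// lee_fin; lra.
  have -> : (4 * A * sg = 2 * A * sg + 2 * A * sg)%R by ring.
  by rewrite EFinD lteD2lE.
have mN : measurable_fun setT (riesz_near alpha s q) by exact: measurable_riesz_near.
have N0 x : 0 <= riesz_near alpha s q x.
  by apply: integral_ge0 => y _; rewrite mule_ge0// lee_fin riesz_kernel_ge0.
have As0 : (0 < 2 * A * sg)%R by rewrite !mulr_gt0.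
have mk := ge0_markov leb measurableT mN (fun x _ => N0 x) As0.
have tn := integral_riesz_near_le alpha0 alphan mq q0 s0.
have h1 := le_trans mk tn.
rewrite [X in _ <= _ * X]integral_mkcond -/q.
apply: (@le_trans _ _ (((2 * A * sg)^-1 * (CN * s `^ alpha))%:E * \int[leb]_y q y)).
  rewrite [X in _ <= X * _]EFinM -muleA -lee_pdivrMl//; last by rewrite invr_gt0.
  rewrite invrK; apply: le_trans h1.
  apply: lee_wpmul2l; first by rewrite lee_fin ltW.
  apply: le_measure => //.
  - apply/mem_set; apply: measurableI => //.
    rewrite -[X in measurable X]setTI; exact: emeasurable_fun_o_infty.
  - apply/mem_set; exact: emeasurable_fun_o_infty.
apply: lee_wpmul2r; first exact: integral_ge0.
rewrite lee_fin -ler_pdivlMl ?invr_gt0 ?mulr_gt0// invrK.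
rewrite ler_pdivlMr ?mulr_gt0//.
have -> : (CN * s `^ alpha * (2 * L * tau) = 2 * (L * CN) * (s `^ alpha * tau))%R by ring.
apply: (@le_trans _ _ (2 * (L * CN) * (C2 * sg)))%R.
  by rewrite ler_wpM2l// mulr_ge0// mulr_ge0 ?(ltW L0) ?(ltW CN0).
have -> : (2 * (L * CN) * (C2 * sg) = 2 * (L * CN * C2) * sg)%R by ring.
by rewrite ler_wpM2r ?(ltW psi0)// ler_wpM2l.
Qed.

(** The volume u is chosen so that psi(Rm / u) = s / (4 A), which makes s the level of the
    superlevel estimate at u; the claim becomes a measure bound by u. Above tau one has g <= (tau u
    / Rl) Phi(g), which even gives u / 2. *)
Lemma weak_modular_le (A s : R) : (A0 <= A)%R -> (CN * C2 <= A)%R -> (0 < s)%R ->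
  (Psi (s / (4 * A)))%:E * leb (D `&` [set x | s%:E < F x]) <= Rm%:E.
Proof.
move=> A0A CA s0; have A_gt0 : (0 < A)%R by exact: lt_le_trans A00 A0A.
set a := (s / (4 * A))%R; have a0 : (0 < a)%R by rewrite divr_gt0// mulr_gt0.
have v0 : (0 < Psi a)%R by exact: orlicz_gt0.
pose u := (Rm / Psi a)%R; have u0 : (0 < u)%R by rewrite divr_gt0.
have Rmu : (Rm / u = Psi a)%R by rewrite /u invf_div mulrC divfK// gt_eqF.
have psia : psi (Rm / u) = a.
  rewrite Rmu; apply/eqP; rewrite eq_le; apply/andP; split.
    rewrite -(orlicz_leE oPsi) ?orlicz_inverse_ge0 ?(ltW a0)//.
    by rewrite orlicz_inverseK ?(ltW v0).
  by rewrite orlicz_inverse_le ?(ltW a0) ?(ltW v0).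
rewrite muleC -lee_pdivlMr// -EFinM -/u.
have mE : measurable (D `&` [set x | s%:E < F x]).
  apply: measurableI => //.
  rewrite -[X in measurable X]setTI; exact: emeasurable_fun_o_infty.
(* For u >= R the measure of the whole of D is already at most u. *)
have [uR|Ru] := ltP u Rr; last first.
  apply: (@le_trans _ _ (leb D)); last by apply: le_trans DR _; rewrite lee_fin.
  by apply: le_measure => //; exact/mem_set.
have CA' : (1 * CN * C2 <= A)%R by rewrite mul1r.
have := superlevel_le (lexx 1%R) A0A CA' u0 uR; rewrite psia mul1r mulr1.
have -> : (4 * A * a)%R = s by rewrite /a mulrC divfK// gt_eqF// mulr_gt0.
move=> /le_trans; apply.
have Plu0 : (0 < Rl / u)%R by rewrite divr_gt0.
set tau := phi (Rl / u).
have tau0 : (0 < tau)%R by exact: orlicz_inverse_gt0.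
have Ptau : Phi tau = (Rl / u)%R by rewrite orlicz_inverseK// ltW.
have mPg : measurable_fun setT (fun y => er_map Phi (g y)).
  exact: (measurable_er_map_orlicz oPhi measurableT mg g0).
apply: (@le_trans _ _ (((2 * tau)^-1)%:E * ((tau * (u / Rl))%:E * Rl%:E))).
  apply: lee_wpmul2l; first by rewrite lee_fin invr_ge0 mulr_ge0// ltW.
  have c0 : (0 < tau * (u / Rl))%R by rewrite mulr_gt0// divr_gt0.
  apply: (@le_trans _ _ ((tau * (u / Rl))%:E * \int[leb]_y er_map Phi (g y))); last first.
    by apply: lee_wpmul2l => //; rewrite lee_fin ltW.
  rewrite -ge0_integralZl//; last 2 first.
  - by move=> y _; exact: er_map_orlicz_ge0.
  - by rewrite lee_fin ltW.
  rewrite [leLHS]integral_mkcond; apply: ge0_le_integral_nomeas => y _.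
    by rewrite patchE; case: ifPn.
  rewrite patchE; case: ifPn => [/set_mem/=|_]; last first.
    by rewrite mule_ge0 ?er_map_orlicz_ge0// lee_fin ltW.
  case: (g y) (g0 y) => [t| |]//=; last by move=> _ _; rewrite gt0_muley ?lte_fin.
  rewrite lee_fin lte_fin -EFinM lee_fin => t0 tt.
  have t1 : (1 <= t / tau)%R by rewrite ler_pdivlMr// mul1r ltW.
  have := orlicz_scale_ge oPhi t1 (ltW tau0).
  rewrite divfK ?gt_eqF// Ptau => /(ler_wpM2l (ltW c0)); apply: le_trans.
  rewrite le_eqVlt; apply/orP; left; apply/eqP.
  by field; rewrite !gt_eqF.
rewrite -!EFinM lee_fin.
have -> : ((2 * tau)^-1 * (tau * (u / Rl) * Rl) = u / 2)%R by field; rewrite !gt_eqF.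
by lra.
Qed.

(** Choosing the truncation radius according to the value of m at x bounds Psi(F/A) pointwise by a
    constant plus a multiple of Phi(m). After integration the constant contributes 2 Rm and the
    modular of m contributes Rm. *)
Lemma strong_modular_maximal_le (C0 : R) (m : Rn R n -> \bar R) :
  (0 < C0)%R -> (forall x, 0 <= m x) ->
  (forall x s, D x -> (0 < s)%R ->
    \int[leb]_(y in eball x s) g y <= ((2 * s) ^+ n)%:E * (C0%:E * m x)) ->
  \int[leb]_(x in D) er_map Phi (m x) <= Rl%:E ->
  \int[leb]_(x in D) er_map Psi (((A0 + CN * C0 * C2)^-1)%:E * F x) <= (3 * Rm)%:E.
Proof.
move=> C00 m0 Hm modm.
have CN0 : (0 < CN)%R by exact: near_constant_gt0.
set A := (A0 + CN * C0 * C2)%R.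
have A_gt0 : (0 < A)%R by rewrite addr_gt0// mulr_gt0// mulr_gt0.
pose G x := er_map Psi ((A^-1)%:E * F x).
have AF0 x : 0 <= (A^-1)%:E * F x by rewrite mule_ge0// lee_fin invr_ge0 ltW.
have G0 x : 0 <= G x by exact: er_map_orlicz_ge0.
have key x : D x -> G x <= (2 * Rm / Rr)%:E + (Rm / Rl)%:E * er_map Phi (m x).
  move=> Dx; have := m0 x; case mx : (m x) => [t| |]//; last first.
    move=> _; rewrite /= gt0_muley ?lte_fin ?divr_gt0//.
    by rewrite addey ?leey.
  rewrite lee_fin => t0 /=; rewrite -EFinM -EFinD.
  have Pt0 : (0 <= Phi t)%R by exact: orlicz_ge0.
  (* The volume used at x is 1/v. The second summand ensures t <= phi(Rl v); the first keeps 1/v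
     below [Rr], even when t = 0. *)
  pose v := (2 / Rr + Phi t / Rl)%R.
  have v0 : (2 / Rr <= v)%R by rewrite lerDl divr_ge0// ltW.
  have iR0 : (0 < 2 / Rr)%R by rewrite divr_gt0.
  have vgt0 : (0 < v)%R by lra.
  have iv0 : (0 < v^-1)%R by rewrite invr_gt0.
  have ivR : (v^-1 < Rr)%R.
    rewrite -[ltRHS]invrK ltf_pV2 ?posrE ?invr_gt0//.
    apply: lt_le_trans v0; rewrite -[ltLHS]mul1r ltr_pM2r ?invr_gt0//; lra.
  have [s s0 su] := exists_radius iv0.
  have uR : ((2 * s) ^+ n < Rr)%R by rewrite su.
  have h1 := HF Dx s0 uR; have h2 := Hs s0 uR.
  rewrite su invrK in h1 h2.
  have tphi : (t <= phi (Rl * v))%R.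
    rewrite orlicz_inverse_le// ?mulr_ge0 ?(ltW Rl0) ?(ltW vgt0)//.
    by rewrite /v mulrDr (mulrC Rl (_ / Rl)%R) divfK ?gt_eqF// lerDr mulr_ge0 ?ltW.
  have h3 : riesz_near alpha s g x <= (CN * s `^ alpha)%:E * (C0%:E * t%:E).
    apply: riesz_near_le => //; first by rewrite -EFinM lee_fin mulr_ge0// ltW.
    by move=> r r0; rewrite -mx; exact: Hm.
  have h4 : F x <= (A * psi (Rm * v))%:E.
    apply: le_trans h1 _; rewrite /A mulrDl EFinD addeC; apply: leeD => //.
    apply: le_trans h3 _; rewrite -!EFinM lee_fin.
    have -> : (CN * s `^ alpha * (C0 * t) = CN * C0 * (s `^ alpha * t))%R by ring.
    have -> : (CN * C0 * C2 * psi (Rm * v) = CN * C0 * (C2 * psi (Rm * v)))%R by ring.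
    rewrite ler_wpM2l//; first by rewrite mulr_ge0 ?(ltW CN0) ?(ltW C00).
    by apply: le_trans h2; rewrite ler_wpM2l ?powR_ge0.
  apply: (@le_trans _ _ (Psi (psi (Rm * v)))%:E).
    rewrite /G -[leRHS]/(er_map Psi (psi (Rm * v))%:E); apply: er_map_orlicz_le => //.
    by rewrite lee_pdivrMl// -EFinM.
  rewrite orlicz_inverseK ?mulr_ge0 ?(ltW Rm0) ?(ltW vgt0)// lee_fin /v.
  by rewrite le_eqVlt; apply/orP; left; apply/eqP; field; rewrite !gt_eqF.
have mG : measurable_fun D G.
  apply: measurable_er_map_orlicz; [exact: oPsi|exact: mD| |exact: AF0].
  apply: measurable_funeM; exact: measurable_funTS.
(* [er_map Phi \o m] need not be measurable: isolate the measurable excess of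
   [G] over the constant before comparing integrals. *)
pose c := (2 * Rm / Rr)%R; have c0 : (0 <= c)%R by rewrite divr_ge0 ?mulr_ge0// ltW.
pose H x := maxe (G x - c%:E) 0.
have mH : measurable_fun D H.
  apply: measurable_maxe; last exact: measurable_cst.
  apply: emeasurable_funB; [exact: mG|exact: measurable_cst].
have H0 x : 0 <= H x by rewrite /H le_max lexx orbT.
have RR0 : (0 < Rl / Rm)%R by rewrite divr_gt0.
have IH : \int[leb]_(x in D) H x <= Rm%:E.
  have : \int[leb]_(x in D) ((Rl / Rm)%:E * H x) <= Rl%:E.
    apply: le_trans modm; apply: ge0_le_integral_nomeas => x Dx.
      by rewrite mule_ge0// lee_fin ltW.
    have P0 : 0 <= er_map Phi (m x) by exact: er_map_orlicz_ge0.
    have h : H x <= (Rm / Rl)%:E * er_map Phi (m x).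
      rewrite /H ge_max mule_ge0 ?andbT//; last by rewrite lee_fin ltW// divr_gt0.
      by rewrite leeBlDl//; exact: key.
    rewrite -[leRHS](_ : (Rl / Rm)%:E * ((Rm / Rl)%:E * er_map Phi (m x)) = _).
      by apply: lee_wpmul2l => //; rewrite lee_fin ltW.
    rewrite muleA -EFinM (_ : (Rl / Rm * (Rm / Rl) = 1)%R) ?mul1e//.
    by field; rewrite !gt_eqF.
  rewrite ge0_integralZl//; last by rewrite lee_fin ltW.
  rewrite -lee_pdivlMl// -EFinM (_ : ((Rl / Rm)^-1 * Rl = Rm)%R)//.
  by field; rewrite !gt_eqF.
apply: (@le_trans _ _ (\int[leb]_(x in D) (c%:E + H x))).
  apply: ge0_le_integral_nomeas => x Dx; first exact: G0.
  by rewrite -leeBlDl// /H le_max lexx.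
rewrite ge0_integralD//.
have -> : (3 * Rm = 2 * Rm + Rm)%R by ring.
rewrite EFinD; apply: leeD => //; rewrite integral_cst//.
apply: (@le_trans _ _ (c%:E * Rr%:E)); first by apply: lee_wpmul2l => //; rewrite lee_fin.
by rewrite -EFinM lee_fin /c divfK// gt_eqF.
Qed.

(** The modular of F is decomposed along the levels e_k = (Rm / Rl) Phi(tau_k). The superlevel
    estimate bounds the set above e_k through g above tau_(k+1), and the staircase gives it weight
    e_(k+1), so a value t of g collects t times the sum of Phi(tau_(k+1)) / (2 tau_(k+1)) over
    tau_(k+1) < t. The growth condition makes these quotients double, so that sum is at most Phi(t)
    / t. *)
Lemma strong_modular_growth_le (L A : R) : (1 < L)%R ->
  (forall u, (0 <= u)%R -> (2 * L * Phi u <= Phi (L * u))%R) ->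
  (A0 <= A)%R -> (L * CN * C2 <= A)%R ->
  \int[leb]_(x in D) er_map Psi (((4 * A)^-1)%:E * F x) <= (3 * Rm)%:E.
Proof.
move=> L1 growth A0A CA; have A_gt0 : (0 < A)%R by exact: lt_le_trans A00 A0A.
have L0 : (0 < L)%R by lra.
have A40 : (0 < 4 * A)%R by rewrite mulr_gt0.
pose c := (Rm / Rl)%R; have c0 : (0 < c)%R by rewrite divr_gt0.
(* The initial height makes Phi(tau_0) = 2 Rl / R, so that every volume Rl / Phi(tau_k) is below R,
   while the bottom level e_0 = 2 Rm / R contributes at most 2 Rm over D. *)
pose tau k := (L ^+ k * phi (2 * Rl / Rr))%R.
have RlRr0 : (0 < 2 * Rl / Rr)%R by rewrite divr_gt0// mulr_gt0.
have tau0 k : (0 < tau k)%R by rewrite mulr_gt0 ?exprn_gt0// orlicz_inverse_gt0.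
have tauS k : tau k.+1 = (L * tau k)%R by rewrite /tau exprS mulrA.
have Ptau0 k : (0 < Phi (tau k))%R by exact: orlicz_gt0.
have PtauS k : (2 * L * Phi (tau k) <= Phi (tau k.+1))%R.
  by rewrite tauS growth// ltW.
have Ptau2 k : (2 * Phi (tau k) <= Phi (tau k.+1))%R.
  apply: le_trans (PtauS k); rewrite ler_wpM2r ?(ltW (Ptau0 k))//; lra.
have Ptau_ge k : (2 ^+ k * (2 * Rl / Rr) <= Phi (tau k))%R.
  elim: k => [|k IH]; first by rewrite /tau !expr0 !mul1r orlicz_inverseK// ltW.
  by apply: le_trans (Ptau2 k); rewrite exprS -mulrA ler_wpM2l.
pose e k := (c * Phi (tau k))%R.
have e0 k : (0 <= e k)%R by rewrite mulr_ge0// ltW.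
have e00 : e 0%N = (2 * Rm / Rr)%R.
  rewrite /e /c /tau expr0 mul1r orlicz_inverseK ?(ltW RlRr0)//.
  by field; rewrite !gt_eqF.
have eoo (r : R) : exists k, (r < e k)%R.
  have [k hk] := expr2_unbounded (r / c / (2 * Rl / Rr)); exists k.
  rewrite /e mulrC -ltr_pdivrMr//; apply: lt_le_trans (Ptau_ge k).
  by rewrite -ltr_pdivrMr.
pose u k := (Rl / Phi (tau k))%R.
have u0 k : (0 < u k)%R by rewrite divr_gt0.
have Rlu k : (Rl / u k = Phi (tau k))%R by rewrite /u invf_div mulrC divfK// gt_eqF.
have Rmu k : (Rm / u k = e k)%R by rewrite /u /e /c; field; rewrite !gt_eqF.
have phiu k : phi (Rl / u k) = tau k.
  rewrite Rlu; apply/eqP; rewrite eq_le; apply/andP; split.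
    rewrite -(orlicz_leE oPhi) ?orlicz_inverse_ge0 ?(ltW (tau0 k))//.
    by rewrite orlicz_inverseK ?(ltW (Ptau0 k)).
  by rewrite orlicz_inverse_le ?(ltW (tau0 k)) ?(ltW (Ptau0 k)).
have uR k : (u k < Rr)%R.
  rewrite /u ltr_pdivrMr// mulrC -ltr_pdivrMr//.
  apply: lt_le_trans (Ptau_ge k); apply: (@lt_le_trans _ _ (2 * Rl / Rr)%R).
    by rewrite ltr_pM2r ?invr_gt0// ltr_pMl// ltr1n.
  by rewrite ler_peMl ?(ltW RlRr0)// exprn_ege1// ler1n.
pose G x := er_map Psi (((4 * A)^-1)%:E * F x).
have AF0 x : 0 <= ((4 * A)^-1)%:E * F x by rewrite mule_ge0// lee_fin invr_ge0 ltW.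
have G0 x : 0 <= G x by exact: er_map_orlicz_ge0.
have mG : measurable_fun setT G.
  apply: measurable_er_map_orlicz; [exact: oPsi|exact: measurableT| |exact: AF0].
  exact: measurable_funeM.
pose E k := [set x | (e k)%:E < G x].
have mE k : measurable (E k).
  rewrite -[X in measurable X]setTI; exact: emeasurable_fun_o_infty.
have level k : leb (D `&` E k) <= ((2 * tau k.+1)^-1)%:E *
    \int[leb]_(y in [set y | (tau k.+1)%:E < g y]) g y.
  have := superlevel_le (ltW L1) A0A CA (u0 k) (uR k).
  rewrite phiu Rmu -tauS -[(2 * L * _)%R]mulrA -tauS; apply: le_trans.
  apply: le_measure.
  - by apply/mem_set; exact: measurableI.
  - apply/mem_set; apply: measurableI => //.
    rewrite -[X in measurable X]setTI; exact: emeasurable_fun_o_infty.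
  - move=> x [Dx /= Ex]; split => //=; rewrite ltNge; apply/negP => Fx.
    move: Ex; rewrite /E/= ltNge => /negP; apply.
    rewrite -[in leRHS](orlicz_inverseK oPsi (e0 k)).
    rewrite -[leRHS]/(er_map Psi (psi (e k))%:E); apply: er_map_orlicz_le => //.
    by rewrite lee_pdivrMl// -EFinM.
pose h k x := (e k.+1)%:E * (\1_(E k) x)%:E.
have h0 k x : 0 <= h k x by rewrite mule_ge0// lee_fin.
have mh k : measurable_fun D (h k).
  apply: measurable_funeM; apply/measurable_EFinP; exact: measurable_indic.
have mE' k : measurable [set y | (tau k)%:E < g y].
  rewrite -[X in measurable X]setTI; exact: emeasurable_fun_o_infty.
apply: (@le_trans _ _ (\int[leb]_(x in D) ((e 0%N)%:E + \sum_(0 <= k <oo) h k x))).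
  apply: ge0_le_integral_nomeas => x Dx; first exact: G0.
  apply: le_trans (staircase_le (G x) e0 eoo) _.
  apply: leeD => //; rewrite le_eqVlt; apply/orP; left; apply/eqP.
  apply: eq_eseriesr => k _; rewrite /h indicE; congr (_ * (nat_of_bool _)%:R%:E).
  by apply/idP/idP => [|/set_mem//]; exact: mem_set.
rewrite ge0_integralD; last 5 first.
- exact: mD.
- by move=> x _; rewrite lee_fin.
- exact: measurable_cst.
- by move=> x _; exact: nneseries_ge0.
- exact: ge0_emeasurable_sum.
have -> : (3 * Rm = 2 * Rm + Rm)%R by ring.
rewrite EFinD; apply: leeD.
  rewrite integral_cst//; apply: (@le_trans _ _ ((e 0%N)%:E * Rr%:E)).
    by apply: lee_wpmul2l => //; rewrite lee_fin.
  by rewrite -EFinM lee_fin e00 divfK// gt_eqF.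
rewrite integral_nneseries//.
pose w k := (e k.+1 * (2 * tau k.+1)^-1)%R.
have w0 k : (0 <= w k)%R by rewrite mulr_ge0// invr_ge0 mulr_ge0// ltW.
pose v k y := (w k)%:E * (g \_ [set y | (tau k.+1)%:E < g y]) y.
have gr0 k y : 0 <= (g \_ [set y | (tau k.+1)%:E < g y]) y.
  by rewrite patchE; case: ifPn.
have v0 k y : 0 <= v k y by rewrite mule_ge0// lee_fin.
have mgr k : measurable_fun setT (g \_ [set y | (tau k.+1)%:E < g y]).
  by apply/(measurable_restrictT _ _).1 => //; exact: measurable_funTS.
apply: (@le_trans _ _ (\sum_(0 <= k <oo) \int[leb]_y v k y)).
  apply: lee_nneseries => [k _ _|k _]; first exact: integral_ge0.
  rewrite /h /v ge0_integralZl; last 4 first.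
  - exact: mD.
  - apply/measurable_EFinP; exact: measurable_indic.
  - by move=> x _; rewrite lee_fin.
  - by rewrite lee_fin.
  rewrite ge0_integralZl; last 4 first.
  - exact: measurableT.
  - exact: mgr.
  - by move=> x _.
  - by rewrite lee_fin.
  rewrite integral_indic// -integral_mkcond setIC.
  have -> : (w k)%:E = (e k.+1)%:E * ((2 * tau k.+1)^-1)%:E by rewrite -EFinM.
  rewrite -muleA; by apply: lee_wpmul2l; [rewrite lee_fin|exact: level].
rewrite -integral_nneseries; last 3 first.
- exact: measurableT.
- by move=> k; exact: measurable_funeM.
- by move=> k y _.
apply: (@le_trans _ _ (\int[leb]_y (c%:E * er_map Phi (g y)))).
  apply: ge0_le_integral_nomeas => y _; first exact: nneseries_ge0.
  apply: nneseries_le_ub => // N.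
  case gy : (g y) (g0 y) => [t| |]// t0; last by rewrite gt0_muley ?lte_fin// leey.
  rewrite lee_fin in t0.
  have vE k : v k y = (c * t * (Phi (tau k.+1) / tau k.+1 / 2 * (tau k.+1 < t)%R%:R))%:E.
    rewrite /v patchE gy; case: ifPn => [/set_mem/=|]; rewrite ?notin_setE/= gy lte_fin.
      move=> ->; rewrite -EFinM /w /e mulr1; congr _%:E.
      by field; rewrite !gt_eqF.
    by move=> /negP/negbTE ->; rewrite mule0 !mulr0.
  rewrite (eq_bigr _ (fun k _ => vE k)) sumEFin -EFinM lee_fin -mulr_sumr.
  move: t0; rewrite le_eqVlt => /predU1P[<-|t0].
    by rewrite mulr0 mul0r mulr_ge0 ?(ltW c0)// orlicz0.
  rewrite -mulrA ler_wpM2l ?(ltW c0)// -ler_pdivlMl// mulrC.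
  (* The doubling is Phi(L tau) / (L tau) >= 2 Phi(tau) / tau; the upper bound by Phi(t) / t is the
     monotonicity of Phi(t) / t, a form of convexity. *)
  apply: doubling_sum_le.
  - by move=> k; rewrite divr_ge0// ltW.
  - move=> k; rewrite ler_pdivlMr//; apply: le_trans (PtauS k.+1).
    rewrite le_eqVlt; apply/orP; left; apply/eqP; rewrite (tauS k.+1).
    by field; rewrite gt_eqF.
  - move=> k tkt; rewrite ler_pdivlMr// mulrAC ler_pdivrMr//.
    have t1 : (1 <= t / tau k.+1)%R by rewrite ler_pdivlMr// mul1r ltW.
    have := orlicz_scale_ge oPhi t1 (ltW (tau0 k.+1)).
    rewrite divfK ?gt_eqF// mulrAC ler_pdivrMr// mulrC.
    exact.
  - by rewrite divr_ge0 ?(ltW t0)// orlicz_ge0// ltW.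
rewrite ge0_integralZl; last 4 first.
- exact: measurableT.
- exact: measurable_er_map_orlicz.
- by move=> y _; exact: er_map_orlicz_ge0.
- by rewrite lee_fin ltW.
apply: (@le_trans _ _ (c%:E * Rl%:E)).
  by apply: lee_wpmul2l => //; rewrite lee_fin ltW.
by rewrite -EFinM lee_fin /c divfK// gt_eqF.
Qed.

End ball_modular.

(** * From modular estimates to Morrey-Orlicz norms *)

Section morrey_orlicz.
Context {R : realType} {n : nat}.
Implicit Types (f : Rn R n -> \bar R) (Phi Psi : R -> R).
Local Notation B r := (eball (@origin R n) r).
Local Open Scope ereal_scope.

Definition scaled_norm f (e : R) (x : Rn R n) : \bar R := `|f x| * (e^-1)%:E.

Lemma scaled_norm_ge0 f e x : (0 < e)%R -> 0 <= scaled_norm f e x.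
Proof. by move=> e0; rewrite mule_ge0// lee_fin invr_ge0 ltW. Qed.

Lemma measurable_scaled_norm f e : measurable_fun setT f ->
  measurable_fun setT (scaled_norm f e).
Proof.
move=> mf; apply: emeasurable_funM; last exact: measurable_cst.
exact: measurableT_comp.
Qed.

(** For signed f the potential is the difference of the integrals of the positive and negative
    parts, and Tonelli makes each of them measurable even where it is infinite. *)
Lemma measurable_riesz alpha f : measurable_fun setT f ->
  measurable_fun setT (riesz alpha f).
Proof.
move=> mf.
pose h (p : Rn R n * Rn R n) := f p.2 * (riesz_kernel alpha p.1 p.2)%:E.
have mh : measurable_fun setT h.
  apply: emeasurable_funM; first exact: (measurableT_comp mf measurable_snd).
  apply/measurable_EFinP; exact: measurable_riesz_kernel.
have -> : riesz alpha f = (fubini_F leb (h^\+)) \- (fubini_F leb (h^\-)).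
  apply/funext => x; rewrite /riesz integralE /fubini_F /=.
  by congr (_ - _); apply: eq_integral => y _; rewrite ?funeposE ?funenegE.
apply: emeasurable_funB.
  apply: measurable_fun_fubini_tonelli_F => //; exact: measurable_funepos.
apply: measurable_fun_fubini_tonelli_F => //; exact: measurable_funeneg.
Qed.

Lemma riesz_ge0 alpha f x : (forall y, 0 <= f y) -> 0 <= riesz alpha f x.
Proof.
move=> f0; apply: integral_ge0 => y _.
by rewrite mule_ge0// lee_fin invr_ge0 powR_ge0.
Qed.

Lemma abse_riesz_le alpha f (e : R) x : measurable_fun setT f -> (0 < e)%R ->
  `|riesz alpha f x| <= e%:E * riesz alpha (scaled_norm f e) x.
Proof.
move=> mf e0; rewrite /riesz -ge0_integralZl; last 4 first.
- exact: measurableT.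
- exact: (measurable_mul_riesz_kernel alpha x (measurable_scaled_norm e mf)).
- by move=> y _; rewrite mule_ge0 ?scaled_norm_ge0// lee_fin invr_ge0 powR_ge0.
- by rewrite lee_fin ltW.
apply: le_trans (le_abse_integral leb measurableT _) _.
  exact: (measurable_mul_riesz_kernel alpha x mf).
rewrite le_eqVlt; apply/orP; left; apply/eqP; apply: eq_integral => y _.
rewrite abseM (gee0_abs (_ : 0 <= _%:E)); last by rewrite lee_fin invr_ge0 powR_ge0.
rewrite muleA; congr (_ * _); rewrite /scaled_norm muleC -muleA -EFinM.
by rewrite mulVf ?mule1// gt_eqF.
Qed.

Lemma luxemburg_norm_lt Phi (lam r e : R) f : orlicz_function Phi ->
  (0 < n)%N -> (0 < r)%R -> (0 < e)%R ->
  luxemburg_norm Phi lam r f < e%:E ->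
  \int[leb]_(x in B r) er_map Phi (scaled_norm f e x) <=
    (fine (leb (B r)) `^ lam)%:E.
Proof.
move=> oPhi n0 r0 e0 /ereal_inf_lt[_ [e' [e'0 He'] <-]]; rewrite lte_fin => ee'.
have b0 : (0 < fine (leb (B r)) `^ lam)%R by rewrite powR_gt0 ?leb_eball_gt0.
rewrite lee_pdivrMl// mule1 in He'; apply: le_trans He'.
apply: ge0_le_integral_nomeas => x _.
  by apply: er_map_orlicz_ge0 => //; exact: scaled_norm_ge0.
apply: er_map_orlicz_le => //; first exact: scaled_norm_ge0.
by apply: lee_wpmul2l => //; rewrite lee_fin lef_pV2 ?posrE// ltW.
Qed.

Lemma luxemburg_norm_le Phi (lam r e : R) f : orlicz_function Phi ->
  (0 < n)%N -> (0 < r)%R -> (0 < e)%R ->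
  \int[leb]_(x in B r) er_map Phi (scaled_norm f e x) <=
    (fine (leb (B r)) `^ lam)%:E ->
  luxemburg_norm Phi lam r f <= e%:E.
Proof.
move=> oPhi n0 r0 e0 H; apply: ereal_inf_lbound; exists e => //; split => //.
by rewrite lee_pdivrMl ?mule1// powR_gt0 ?leb_eball_gt0.
Qed.

Lemma luxemburg_norm_ge0 Phi (lam r : R) f : 0 <= luxemburg_norm Phi lam r f.
Proof. by apply: le_ereal_inf_tmp => _ [e [e0 _] <-]; rewrite lee_fin ltW. Qed.

Lemma morrey_norm_ge0 Phi (lam : R) f : 0 <= morrey_norm Phi lam f.
Proof.
apply: le_trans (luxemburg_norm_ge0 Phi lam 1 f) _.
apply: ereal_sup_ubound; exists 1%R => //=; exact: ltr01.
Qed.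

Lemma morrey_norm_lt Phi (lam r e : R) f : orlicz_function Phi ->
  (0 < n)%N -> (0 < r)%R -> (0 < e)%R -> morrey_norm Phi lam f < e%:E ->
  \int[leb]_(x in B r) er_map Phi (scaled_norm f e x) <=
    (fine (leb (B r)) `^ lam)%:E.
Proof.
move=> oPhi n0 r0 e0 fe; apply: luxemburg_norm_lt => //; apply: le_lt_trans fe.
by apply: ereal_sup_ubound; exists r.
Qed.

(** Working with every e above the norm, instead of dividing by the norm itself, covers the case of
    norm 0 and does not require the infimum to be attained. *)
Lemma le_mul_of_lt (C : R) (N X : \bar R) : (0 < C)%R -> 0 <= N -> N < +oo ->
  (forall e : R, (0 < e)%R -> N < e%:E -> X <= (C * e)%:E) -> X <= C%:E * N.
Proof.
case: N => [N| |]// C0; rewrite lee_fin => N0 _ H.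
apply/lee_addgt0Pr => d d0; rewrite -EFinM -EFinD.
have -> : (C * N + d = C * (N + d / C))%R by rewrite mulrDr mulrCA mulfV ?mulr1// gt_eqF.
have dC : (0 < d / C)%R by rewrite divr_gt0.
by apply: H; rewrite ?lte_fin ?ltrDl// ltr_wpDl.
Qed.

(** The inscribed cube gives (16 r)^n <= (8 (n + 1))^n |B_r|. As mu <= 1 and the factor is at least
    1, its power mu is bounded by the factor itself, so the constant does not involve mu. *)
Lemma leb_ball_growth (r mu : R) : (0 < n)%N -> (0 < r)%R -> (0 <= mu <= 1)%R ->
  (((16 * r) ^+ n) `^ mu <= (8 * n.+1%:R) ^+ n * fine (leb (B r)) `^ mu)%R.
Proof.
move=> n0 r0 /andP[mu0 mu1].
have b0 : (0 < fine (leb (B r)))%R by exact: leb_eball_gt0.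
have K1 : (1 <= (8 * n.+1%:R) ^+ n :> R)%R.
  by rewrite exprn_ege1// -natrM ler1n.
have K0 : (0 <= (8 * n.+1%:R) ^+ n :> R)%R by rewrite (le_trans _ K1).
apply: (@le_trans _ _ (((8 * n.+1%:R) ^+ n * fine (leb (B r))) `^ mu)%R).
  apply: ge0_ler_powR; rewrite ?nnegrE// ?mulr_ge0 ?exprn_ge0 ?mulr_ge0 ?(ltW r0) ?(ltW b0)//.
  have := leb_eball_ge (@origin R n) n0 r0.
  rewrite -[leb _]fineK ?leb_eball_fin// lee_fin => /(ler_wpM2l K0); apply: le_trans.
  rewrite -exprMn le_eqVlt; apply/orP; left; apply/eqP; congr (_ ^+ _)%R.
  have : (n.+1%:R != 0 :> R)%R by rewrite pnatr_eq0.
  by move: (n.+1%:R)%R => N N0; field.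
rewrite powRM ?(ltW b0)// ler_wpM2r ?powR_ge0//.
by rewrite -[leRHS](powRr1 K0) ler_powR.
Qed.

Section riesz_bounds.
Variables (alpha lambda mu C : R) (Phi Psi : R -> R).
Hypotheses (n0 : (0 < n)%N) (oPhi : orlicz_function Phi) (oPsi : orlicz_function Psi).
Hypothesis C0 : (0 < C)%R.

Lemma riesz_bound_of_modular :
  (forall f, morrey_space Phi lambda f -> L1loc (riesz alpha f)) ->
  (forall f e r, morrey_space Phi lambda f -> (0 < e)%R ->
     morrey_norm Phi lambda f < e%:E -> (0 < r)%R ->
     \int[leb]_(x in B r) er_map Psi ((C^-1)%:E * riesz alpha (scaled_norm f e) x)
       <= (fine (leb (B r)) `^ mu)%:E) ->
  riesz_bound n alpha Phi lambda Psi mu C.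
Proof.
move=> HL H f Mf; have [[mf _] fN] := Mf.
have le : morrey_norm Psi mu (riesz alpha f) <= C%:E * morrey_norm Phi lambda f.
  apply: le_mul_of_lt => //; first exact: morrey_norm_ge0.
  move=> e e0 fe; apply: ge_ereal_sup => _ [r r0 <-].
  apply: luxemburg_norm_le => //; first by rewrite mulr_gt0.
  apply: le_trans (H f e r Mf e0 fe r0).
  have Ce0 : (0 < C * e)%R by rewrite mulr_gt0.
  apply: ge0_le_integral_nomeas => x _.
    by apply: er_map_orlicz_ge0 => //; exact: scaled_norm_ge0.
  apply: er_map_orlicz_le => //; first exact: scaled_norm_ge0.
  rewrite /scaled_norm invfM EFinM muleCA.
  apply: lee_wpmul2l; first by rewrite lee_fin invr_ge0 ltW.
  by rewrite muleC lee_pdivrMl//; exact: abse_riesz_le.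
split; last exact: le.
split; first exact: (HL f Mf).
by apply: le_lt_trans le _; rewrite lte_mul_pinfty// lee_fin ltW.
Qed.

Lemma weak_riesz_bound_of_modular :
  (forall f, morrey_space Phi lambda f -> L1loc (riesz alpha f)) ->
  (forall f e r s, morrey_space Phi lambda f -> (0 < e)%R ->
     morrey_norm Phi lambda f < e%:E -> (0 < r)%R -> (0 < s)%R ->
     (Psi (s / C))%:E *
       leb (B r `&` [set x | s%:E < riesz alpha (scaled_norm f e) x])
       <= (fine (leb (B r)) `^ mu)%:E) ->
  weak_riesz_bound n alpha Phi lambda Psi mu C.
Proof.
move=> HL H f Mf; have [[mf _] fN] := Mf.
have le : weak_morrey_norm Psi mu (riesz alpha f) <= C%:E * morrey_norm Phi lambda f.
  apply: le_mul_of_lt => //; first exact: morrey_norm_ge0.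
  move=> e e0 fe; apply: ge_ereal_sup => _ [r r0 <-].
  have Ce0 : (0 < C * e)%R by rewrite mulr_gt0.
  apply: ereal_inf_lbound; exists (C * e)%R => //; split => //.
  apply: ge_ereal_sup => _ [u u0 <-].
  have b0 : (0 < fine (leb (B r)) `^ mu)%R by rewrite powR_gt0 ?leb_eball_gt0.
  have ue0 : (0 < u / e)%R by rewrite divr_gt0.
  have HH := H f e r (u / e)%R Mf e0 fe r0 ue0.
  rewrite mulrC EFinM -muleA lee_pdivrMl// mule1.
  apply: le_trans HH.
  have -> : (u / e / C = u / (C * e))%R by field; rewrite !gt_eqF.
  apply: lee_wpmul2l.
    by rewrite lee_fin orlicz_ge0// divr_ge0// ltW.
  have mriesz := measurable_riesz alpha mf.
  have mg := measurable_riesz alpha (measurable_scaled_norm e mf).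
  have m1 : measurable_fun setT (fun x => riesz alpha f x * (\1_(B r) x)%:E).
    apply: emeasurable_funM; first exact: mriesz.
    by apply/measurable_EFinP; apply: measurable_indic; exact: measurable_eball.
  have m2 : measurable_fun setT (fun x => `|riesz alpha f x * (\1_(B r) x)%:E|).
    exact: measurableT_comp.
  apply: le_measure.
  - apply/mem_set; rewrite -[X in measurable X]setTI.
    exact: (emeasurable_fun_o_infty measurableT m2).
  - apply/mem_set; apply: measurableI; first exact: measurable_eball.
    rewrite -[X in measurable X]setTI.
    exact: (emeasurable_fun_o_infty measurableT mg).
  - move=> x /=; rewrite indicE; case: (boolP (x \in B r)) => [/set_mem xB|_]; last first.
      by rewrite mule0 abse0 lte_fin ltNge (ltW u0).
    rewrite mule1 => ux; split => //.
    have := lt_le_trans ux (abse_riesz_le alpha x mf e0).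
    by rewrite -(lte_pdivrMl _ _ e0) -EFinM mulrC.
split; last exact: le.
split; first exact: (HL f Mf).
by apply: le_lt_trans le _; rewrite lte_mul_pinfty// lee_fin ltW.
Qed.

End riesz_bounds.

End morrey_orlicz.

(** * Boundedness of the Riesz potential *)

Section riesz_boundedness.
Context {R : realType} {n : nat} (alpha lambda mu : R) (Phi Psi : R -> R) (C1 C2 : R).
Hypotheses (n0 : (0 < n)%N) (alpha0 : 0 < alpha) (alphan : alpha < n%:R).
Hypotheses (oPhi : orlicz_function Phi) (oPsi : orlicz_function Psi).
Hypotheses (lambda0 : 0 <= lambda) (lambda1 : lambda < 1) (mu0 : 0 <= mu) (mu1 : mu < 1).
Hypotheses (C11 : 1 <= C1) (C21 : 1 <= C2).
Hypothesis H1 : forall u : R, 0 < u ->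
      (\int[lebesgue_measure]_(t in `]u, +oo[)
          ((t `^ (alpha / n%:R))%:E *
           generalized_inverse Phi (t `^ (lambda - 1)) * (t^-1)%:E)
        <= C1%:E * generalized_inverse Psi (u `^ (mu - 1)))%E.
Hypothesis H2 : forall r u : R, 0 < u -> u < r ->
      ((u `^ (alpha / n%:R))%:E * generalized_inverse Phi (r `^ lambda / u)%R +
       \int[lebesgue_measure]_(t in `]u, r[)
          ((t `^ (alpha / n%:R))%:E *
           generalized_inverse Phi (r `^ lambda / t)%R * (t^-1)%:E)
        <= C2%:E * generalized_inverse Psi (r `^ mu / u)%R)%E.
Local Notation B r := (eball (@origin R n) r).
Local Notation CN := (near_constant (n := n) alpha).

(** The two terms are the contributions of the shells around x that meet B_2r and of the tail. *)
Definition far_constant (k : nat) (c1 c2 : R) : R :=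
  4 * 4 ^+ k * c2 + 4 * 32 ^+ k * c1.
Definition growth_constant (k : nat) : R := (8 * k.+1%:R) ^+ k.

Lemma growth_constant_ge1 k : 1 <= growth_constant k.
Proof. by rewrite exprn_ege1// -natrM ler1n. Qed.

Lemma far_constant_ge1 k c1 c2 : 1 <= c1 -> 1 <= c2 -> 1 <= far_constant k c1 c2.
Proof.
move=> c11 c21.
have h4 : 1 <= 4 ^+ k :> R by rewrite exprn_ege1// ler1n.
have h32 : 1 <= 32 ^+ k :> R by rewrite exprn_ege1// ler1n.
rewrite /far_constant; nra.
Qed.

Local Notation A0 := (far_constant n C1 C2).
Local Notation K := (growth_constant n).

Section fixed_function.
Variables (f : Rn R n -> \bar R) (e r : R).
Hypotheses (Mf : morrey_space Phi lambda f) (e0 : 0 < e) (r0 : 0 < r).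
Hypothesis fe : (morrey_norm Phi lambda f < e%:E)%E.
Let g := scaled_norm f e.
Let g1 := g \_ (B (2 * r)).
Let Rr := (16 * r) ^+ n.
Local Open Scope ereal_scope.

Let mf : measurable_fun setT f. Proof. by case: Mf => -[]. Qed.

Let mg : measurable_fun setT g. Proof. exact: measurable_scaled_norm. Qed.

Let g0 x : 0 <= g x. Proof. exact: scaled_norm_ge0. Qed.

Let Hg (s : R) : (0 < s)%R ->
  \int[leb]_(y in B s) er_map Phi (g y) <= (fine (leb (B s)) `^ lambda)%:E.
Proof. by move=> s0; exact: morrey_norm_lt. Qed.

Let mF : measurable_fun setT (riesz alpha g). Proof. exact: measurable_riesz. Qed.

Let F0 x : 0 <= riesz alpha g x. Proof. exact: riesz_ge0. Qed.

Let mg1 : measurable_fun setT g1. Proof. exact: measurable_inner. Qed.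

Let g10 x : 0 <= g1 x. Proof. exact: inner_ge0. Qed.

Let Rr0 : (0 < Rr)%R. Proof. by rewrite exprn_gt0// mulr_gt0. Qed.

Let DR : leb (B r) <= Rr%:E.
Proof.
apply: le_trans (leb_eball_le _ (ltW r0)) _; rewrite lee_fin /Rr.
by apply: lerXn2r; rewrite ?nnegrE ?mulr_ge0 ?(ltW r0)// ler_wpM2r ?(ltW r0)// ler_nat.
Qed.

Let modg : \int[leb]_y er_map Phi (g1 y) <= (Rr `^ lambda)%:E.
Proof. exact: inner_modular_le. Qed.

Let HF x s : B r x -> (0 < s)%R -> ((2 * s) ^+ n < Rr)%R ->
  riesz alpha g x <= riesz_near alpha s g1 x + (A0 * orlicz_inverse Psi (Rr `^ mu / (2 * s) ^+ n))%:E.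
Proof.
move=> Bx s0 sR; apply: (@riesz_inner_le _ _ alpha lambda mu Phi Psi C1 C2) => //.
by rewrite (le_trans _ C11).
Qed.

Let Hs s : (0 < s)%R -> ((2 * s) ^+ n < Rr)%R ->
  (s `^ alpha * orlicz_inverse Phi (Rr `^ lambda / (2 * s) ^+ n) <=
   C2 * orlicz_inverse Psi (Rr `^ mu / (2 * s) ^+ n))%R.
Proof. by move=> s0 sR; exact: (@first_term_le _ _ alpha lambda mu Phi Psi C2). Qed.

Let Rl0 : (0 < Rr `^ lambda)%R. Proof. exact: powR_gt0. Qed.
Let Rm0 : (0 < Rr `^ mu)%R. Proof. exact: powR_gt0. Qed.
Let A00 : (0 < A0)%R. Proof. by rewrite (lt_le_trans ltr01)// far_constant_ge1. Qed.
Let C20 : (0 < C2)%R. Proof. exact: lt_le_trans C21. Qed.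
Let K0 : (0 < K)%R. Proof. by rewrite (lt_le_trans ltr01)// growth_constant_ge1. Qed.

Let RmK : (Rr `^ mu <= K * fine (leb (B r)) `^ mu)%R.
Proof. by apply: leb_ball_growth => //; rewrite mu0 ltW. Qed.

(** Convexity gives Psi(z / (3 K)) <= Psi(z) / (3 K), which cancels both the 3 of the modular
    estimates and the factor K between R^mu and |B_r|^mu. *)
Lemma riesz_modular_rescale (A : R) : (0 < A)%R ->
  \int[leb]_(x in B r) er_map Psi ((A^-1)%:E * riesz alpha g x) <= (3 * Rr `^ mu)%:E ->
  \int[leb]_(x in B r) er_map Psi (((3 * K * A)^-1)%:E * riesz alpha g x) <=
    (fine (leb (B r)) `^ mu)%:E.
Proof.
move=> A_gt0 H; have K1 := growth_constant_ge1 n.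
have K30 : (0 < (3 * K)^-1)%R by rewrite invr_gt0 mulr_gt0.
have AF0 x : 0 <= (A^-1)%:E * riesz alpha g x by rewrite mule_ge0// lee_fin invr_ge0 ltW.
apply: (@le_trans _ _ (\int[leb]_(x in B r)
    (((3 * K)^-1)%:E * er_map Psi ((A^-1)%:E * riesz alpha g x)))).
  apply: ge0_le_integral_nomeas => x _.
    by apply: er_map_orlicz_ge0 => //; rewrite mule_ge0// lee_fin invr_ge0 !mulr_ge0 ?ltW.
  rewrite invfM EFinM -muleA; apply: er_map_orlicz_scale => //.
  by rewrite K30/= invf_le1 ?mulr_gt0//; lra.
rewrite ge0_integralZl; last 4 first.
- exact: measurable_eball.
- apply: measurable_er_map_orlicz; [exact: oPsi|exact: measurable_eball| |exact: AF0].
  by apply: measurable_funeM; exact: measurable_funTS.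
- by move=> x _; exact: er_map_orlicz_ge0.
- by rewrite lee_fin ltW.
rewrite lee_pdivrMl ?mulr_gt0//; apply: le_trans H _.
by rewrite -EFinM lee_fin -mulrA ler_wpM2l.
Qed.

Lemma riesz_weak_modular (s : R) : (0 < s)%R ->
  (Psi (s / (4 * K * (A0 + CN * C2))))%:E *
    leb (B r `&` [set x | s%:E < riesz alpha g x]) <= (fine (leb (B r)) `^ mu)%:E.
Proof.
move=> s0; have CN0 : (0 < CN)%R by exact: near_constant_gt0.
set A := (A0 + CN * C2)%R.
have CNC : (0 < CN * C2)%R by rewrite mulr_gt0.
have A0A : (A0 <= A)%R by rewrite lerDl ltW.
have CA : (CN * C2 <= A)%R by rewrite lerDr ltW.
have A_gt0 : (0 < A)%R by exact: lt_le_trans A0A.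
have := weak_modular_le n0 alpha0 alphan oPhi oPsi (measurable_eball _ r) mF mg1 g10
  Rl0 Rm0 A00 DR modg HF Hs A0A CA s0.
move=> H; have K1 := growth_constant_ge1 n.
apply: (@le_trans _ _ ((K^-1)%:E * ((Psi (s / (4 * A)))%:E *
    leb (B r `&` [set x | s%:E < riesz alpha g x])))).
  rewrite muleA; apply: lee_wpmul2r => //; rewrite -EFinM lee_fin.
  have -> : (s / (4 * K * A) = K^-1 * (s / (4 * A)))%R by field; rewrite !gt_eqF.
  apply: orlicz_scale => //; last by rewrite divr_ge0 ?mulr_ge0// ltW.
  by rewrite invr_ge0 (ltW K0)/= invf_le1.
by rewrite lee_pdivrMl//; apply: le_trans H _; rewrite -EFinM lee_fin.
Qed.

Lemma riesz_strong_modular_maximal (c : R) : (0 < c)%R ->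
  maximal_bound n Phi lambda c ->
  \int[leb]_(x in B r) er_map Psi (((3 * K * (A0 + CN * c * C2))^-1)%:E * riesz alpha g x)
    <= (fine (leb (B r)) `^ mu)%:E.
Proof.
move=> c0 Hmax; have CN0 : (0 < CN)%R by exact: near_constant_gt0.
apply: riesz_modular_rescale; first by rewrite addr_gt0// mulr_gt0// mulr_gt0.
(* The maximal function of f has norm below c e, so |M f| / (c e) has controlled modular; the
   averages of |f| / e are then bounded by c times it. *)
have ce0 : (0 < c * e)%R by rewrite mulr_gt0.
apply: (strong_modular_maximal_le n0 alpha0 alphan oPhi oPsi (measurable_eball _ r)
  mF F0 mg1 g10 Rr0 Rl0 Rm0 A00 C20 DR HF Hs (m := scaled_norm (maximal f) (c * e)) c0).
- by move=> x; exact: scaled_norm_ge0.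
- move=> x s Bx s0.
  apply: (@le_trans _ _ ((e^-1)%:E * \int[leb]_(y in eball x s) `|f y|)).
    rewrite -ge0_integralZl; last 4 first.
    - exact: measurable_eball.
    - by apply: measurable_funTS; exact: measurableT_comp.
    - by move=> y _; exact: abse_ge0.
    - by rewrite lee_fin invr_ge0 ltW.
    apply: ge0_le_integral_nomeas => y _; first exact: g10.
    rewrite /g1 patchE muleC; case: ifPn => // _.
    by rewrite mule_ge0// lee_fin invr_ge0 ltW.
  have b0 := leb_eball_gt0 x n0 s0.
  have bE : leb (eball x s) = (fine (leb (eball x s)))%:E by rewrite fineK ?leb_eball_fin.
  have Mx : \int[leb]_(y in eball x s) `|f y| <= leb (eball x s) * maximal f x.
    rewrite bE -lee_pdivrMl//.
    apply: ereal_sup_ubound; exists s => //; congr (_ * _).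
    by rewrite bE inver gt_eqF.
  have Mx0 : 0 <= maximal f x.
    apply: le_trans (_ : 0 <= (leb (eball x s))^-1 * \int[leb]_(y in eball x s) `|f y|) _.
      by rewrite mule_ge0 ?inve_ge0 ?integral_ge0.
    by apply: ereal_sup_ubound; exists s.
  apply: (@le_trans _ _ ((e^-1)%:E * (((2 * s) ^+ n)%:E * maximal f x))).
    apply: lee_wpmul2l; first by rewrite lee_fin invr_ge0 ltW.
    apply: le_trans Mx _; apply: lee_wpmul2r => //.
    by apply: leb_eball_le; exact: ltW.
  rewrite /scaled_norm gee0_abs// muleCA.
  apply: lee_wpmul2l; first by rewrite lee_fin exprn_ge0// mulr_ge0// ltW.
  rewrite (muleC (maximal f x)) muleA -EFinM invfM mulrA mulfV ?mul1r//.
  by rewrite gt_eqF.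
- apply: (@le_trans _ _ (fine (leb (B r)) `^ lambda)%:E).
    apply: morrey_norm_lt => //; apply: le_lt_trans (Hmax f Mf) _.
    by rewrite EFinM lte_pmul2l.
  rewrite lee_fin leb_ball_powR_le//.
  rewrite /Rr; apply: lerXn2r; rewrite ?nnegrE ?mulr_ge0 ?(ltW r0)//.
  by rewrite ler_wpM2r ?(ltW r0)// ler_nat.
Qed.

Lemma riesz_strong_modular_growth (L : R) : (1 < L)%R ->
  (forall u, (0 <= u)%R -> (2 * L * Phi u <= Phi (L * u))%R) ->
  \int[leb]_(x in B r)
      er_map Psi (((3 * K * (4 * (A0 + L * CN * C2)))^-1)%:E * riesz alpha g x)
    <= (fine (leb (B r)) `^ mu)%:E.
Proof.
move=> L1 growth; have CN0 : (0 < CN)%R by exact: near_constant_gt0.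
have L0 : (0 < L)%R by lra.
have CNC : (0 < L * CN * C2)%R by rewrite mulr_gt0// mulr_gt0.
have A0A : (A0 <= A0 + L * CN * C2)%R by rewrite lerDl ltW.
have CA : (L * CN * C2 <= A0 + L * CN * C2)%R by rewrite lerDr ltW.
apply: riesz_modular_rescale; first by rewrite mulr_gt0// addr_gt0.
exact: (strong_modular_growth_le n0 alpha0 alphan oPhi oPsi (measurable_eball _ r)
  mF F0 mg1 g10 Rr0 Rl0 Rm0 A00 DR modg HF Hs L1 growth A0A CA).
Qed.

(** At one fixed truncation radius the potential is a bounded function plus the truncated potential
    of g1; the latter is integrable because g1 is, by the Jensen inequality. The choice u = R / 2
    merely satisfies u < R. *)
Lemma riesz_integrable_ball : leb.-integrable (B r) (riesz alpha f).
Proof.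
apply/integrableP; split; first by apply: measurable_funTS; exact: measurable_riesz.
have Rr20 : (0 < Rr / 2)%R by rewrite divr_gt0.
have [s s0 sR] := exists_radius n0 Rr20.
have sRr : ((2 * s) ^+ n < Rr)%R by rewrite sR ltr_pdivrMr// ltr_pMr// ltr1n.
set d := (A0 * orlicz_inverse Psi (Rr `^ mu / (2 * s) ^+ n))%R.
have d0 : (0 <= d)%R by rewrite mulr_ge0 ?(ltW A00)// orlicz_inverse_ge0.
have CN0 : (0 < CN)%R by exact: near_constant_gt0.
have near0 x : 0 <= riesz_near alpha s g1 x.
  by apply: integral_ge0 => y _; rewrite mule_ge0// lee_fin riesz_kernel_ge0.
have mnear : measurable_fun setT (riesz_near alpha s g1) by exact: measurable_riesz_near.
apply: (@le_lt_trans _ _ (e%:E * \int[leb]_(x in B r) (riesz_near alpha s g1 x + d%:E))).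
  rewrite -ge0_integralZl; last 4 first.
  - exact: measurable_eball.
  - by apply: measurable_funTS; apply: emeasurable_funD => //; exact: measurable_cst.
  - by move=> x _; rewrite adde_ge0.
  - by rewrite lee_fin ltW.
  apply: ge0_le_integral_nomeas => // x Bx.
  apply: le_trans (abse_riesz_le alpha x mf e0) _.
  by apply: lee_wpmul2l; [rewrite lee_fin ltW|exact: HF].
rewrite lte_mul_pinfty ?lee_fin ?(ltW e0)// ge0_integralD; last 5 first.
- exact: measurable_eball.
- by move=> x _.
- exact: measurable_funTS.
- by move=> x _; rewrite lee_fin.
- exact: measurable_cst.
apply: lte_add_pinfty; last first.
  rewrite integral_cst; last exact: measurable_eball.
  by rewrite lte_mul_pinfty ?lee_fin// ltey_eq leb_eball_fin.
apply: (@le_lt_trans _ _ (\int[leb]_x riesz_near alpha s g1 x)).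
  exact: ge0_subset_integral_nomeas.
apply: le_lt_trans (integral_riesz_near_le alpha0 alphan mg1 g10 s0) _.
have c0 : (0 <= CN * s `^ alpha)%R by rewrite mulr_ge0 ?powR_ge0// (ltW CN0).
rewrite lte_mul_pinfty ?lee_fin//.
have r20 : (0 < 2 * r)%R by rewrite mulr_gt0.
rewrite /g1 -integral_mkcond; apply: le_lt_trans (ltry _).
apply: (orlicz_integral_le oPhi (measurable_eball _ _) (measurable_funTS mg) g0 _ _ _ (Hg r20)).
- exact: Rr0.
- by rewrite powR_gt0// leb_eball_gt0.
- apply: le_trans (leb_eball_le _ (ltW r20)) _; rewrite lee_fin.
  rewrite mulrA /Rr; apply: lerXn2r; rewrite ?nnegrE ?mulr_ge0 ?(ltW r0)//.
  by rewrite ler_wpM2r ?(ltW r0)// -natrM ler_nat.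
Qed.

End fixed_function.

Lemma riesz_L1loc (f : Rn R n -> \bar R) : morrey_space Phi lambda f -> L1loc (riesz alpha f).
Proof.
move=> Mf; have [[mf _] fN] := Mf; split; first exact: measurable_riesz.
move=> r r0; pose N := fine (morrey_norm Phi lambda f).
have NE : morrey_norm Phi lambda f = N%:E.
  by rewrite /N fineK// ge0_fin_numE// morrey_norm_ge0.
have N0 : 0 <= N by rewrite -lee_fin -NE morrey_norm_ge0.
apply: (@riesz_integrable_ball f (N + 1) r Mf _ r0); first by rewrite ltr_wpDl.
by rewrite NE lte_fin ltrDl.
Qed.

Lemma weak_riesz_bounded :
  weak_riesz_bound n alpha Phi lambda Psi mu (4 * K * (A0 + CN * C2)).
Proof.
apply: weak_riesz_bound_of_modular; [exact: n0|exact: oPsi| | |].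
- rewrite mulr_gt0 ?mulr_gt0 ?(lt_le_trans ltr01 (growth_constant_ge1 _))//.
  rewrite addr_gt0 ?(lt_le_trans ltr01 (far_constant_ge1 _ _ _))//.
  by rewrite mulr_gt0 ?near_constant_gt0// (lt_le_trans ltr01).
- exact: riesz_L1loc.
- by move=> f e r s Mf e0 fe r0 s0; exact: riesz_weak_modular.
Qed.

Lemma riesz_bounded_maximal (c : R) : 0 < c -> maximal_bound n Phi lambda c ->
  riesz_bound n alpha Phi lambda Psi mu (3 * K * (A0 + CN * c * C2)).
Proof.
move=> c0 Hc; apply: riesz_bound_of_modular; [exact: n0|exact: oPsi| | |].
- rewrite mulr_gt0 ?mulr_gt0 ?(lt_le_trans ltr01 (growth_constant_ge1 _))//.
  rewrite addr_gt0 ?(lt_le_trans ltr01 (far_constant_ge1 _ _ _))//.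
  by rewrite mulr_gt0 ?(lt_le_trans ltr01 C21)// mulr_gt0 ?near_constant_gt0.
- exact: riesz_L1loc.
- by move=> f e r Mf e0 fe r0; exact: riesz_strong_modular_maximal.
Qed.

Lemma riesz_bounded_growth (L : R) : 1 < L ->
  (forall u, 0 <= u -> 2 * L * Phi u <= Phi (L * u)) ->
  riesz_bound n alpha Phi lambda Psi mu (3 * K * (4 * (A0 + L * CN * C2))).
Proof.
move=> L1 growth; apply: riesz_bound_of_modular; [exact: n0|exact: oPsi| | |].
- rewrite mulr_gt0 ?mulr_gt0 ?(lt_le_trans ltr01 (growth_constant_ge1 _))//.
  rewrite addr_gt0 ?(lt_le_trans ltr01 (far_constant_ge1 _ _ _))//.
  rewrite mulr_gt0 ?(lt_le_trans ltr01 C21)// mulr_gt0 ?near_constant_gt0//; lra.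
- exact: riesz_L1loc.
- by move=> f e r Mf e0 fe r0; exact: riesz_strong_modular_growth.
Qed.

End riesz_boundedness.

(** Dividing C_H by 2^n v_n leaves 1 / (2^alpha - 1). This recovers the only quantity depending on
    alpha from arguments that the final constants are allowed to have. *)
Lemma near_constant_hedberg (R : realType) (n : nat) (alpha : R) : (0 < n)%N ->
  4 ^+ n * (hedberg_constant n alpha / (2 ^+ n * fine (leb (eball (@origin R n) 1)))) =
  near_constant (n := n) alpha.
Proof.
move=> n0; rewrite /hedberg_constant /near_constant.
have v0 : fine (leb (eball (@origin R n) 1)) != 0 by rewrite gt_eqF// leb_eball_gt0.
have p0 : 2 ^+ n != 0 :> R by rewrite expf_neq0// pnatr_eq0.
congr (_ * _); move: (fine _) (2 ^+ n) (_^-1) v0 p0 => v p w v0 p0.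
by field; rewrite v0 p0.
Qed.

Unset Implicit Arguments.
Set Strict Implicit.

Theorem theorem1 (R : realType) :
  exists C3 c3 : nat -> R -> R -> R -> R -> R,
  forall (n : nat) (alpha lambda mu : R) (Phi Psi : R -> R) (C1 C2 : R),
    (1 <= n)%N -> 0 < alpha < n%:R ->
    orlicz_function Phi -> orlicz_function Psi ->
    (0 < lambda < 1 /\ 0 < mu < 1 /\ lambda <> mu) \/
      (lambda = 0 /\ 0 <= mu < 1) ->
    1 <= C1 -> 1 <= C2 ->
    (forall u : R, 0 < u ->
      (\int[lebesgue_measure]_(t in `]u, +oo[)
          ((t `^ (alpha / n%:R))%:E *
           generalized_inverse Phi (t `^ (lambda - 1)) * (t^-1)%:E)
        <= C1%:E * generalized_inverse Psi (u `^ (mu - 1)))%E) ->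
    (forall r u : R, 0 < u -> u < r ->
      ((u `^ (alpha / n%:R))%:E * generalized_inverse Phi (r `^ lambda / u)%R +
       \int[lebesgue_measure]_(t in `]u, r[)
          ((t `^ (alpha / n%:R))%:E *
           generalized_inverse Phi (r `^ lambda / t)%R * (t^-1)%:E)
        <= C2%:E * generalized_inverse Psi (r `^ mu / u)%R)%E) ->
    (Delta2 (complementary Phi) ->
      (exists C : R, 1 <= C /\ riesz_bound n alpha Phi lambda Psi mu C) /\
      (forall C0 : R, 1 < C0 -> maximal_bound n Phi lambda C0 ->
        let C := C3 n C0 (hedberg_constant n alpha) C1 C2 in
        1 <= C /\ riesz_bound n alpha Phi lambda Psi mu C)) /\
    ((exists c : R, 1 <= c /\ weak_riesz_bound n alpha Phi lambda Psi mu c) /\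
     (forall c0 : R, 1 < c0 -> weak_maximal_bound n Phi lambda c0 ->
        let c := c3 n c0 (hedberg_constant n alpha) C1 C2 in
        1 <= c /\ weak_riesz_bound n alpha Phi lambda Psi mu c)).
Proof.
pose N k (h : R) := 4 ^+ k * (h / (2 ^+ k * fine (leb (eball (@origin R k) 1)))).
pose C3 k c h C1 C2 := 3 * growth_constant k * (far_constant k C1 C2 + N k h * c * C2).
pose c3 k (c h C1 C2 : R) := 4 * growth_constant k * (far_constant k C1 C2 + N k h * C2).
exists C3, c3 => n alpha lambda mu Phi Psi C1 C2 n0 /andP[alpha0 alphan] oPhi oPsi lm
  C11 C21 H1 H2.
have NE : N n (hedberg_constant n alpha) = near_constant (n := n) alpha.
  exact: near_constant_hedberg.
have CN0 : 0 < near_constant (n := n) alpha by exact: near_constant_gt0.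
have C20 : 0 < C2 by exact: lt_le_trans C21.
have [lambda0 lambda1 mu0 mu1] : [/\ 0 <= lambda, lambda < 1, 0 <= mu & mu < 1].
  case: lm => [[/andP[l0 l1] [/andP[m0 m1] _]]|[-> /andP[m0 m1]]].
    by split => //; exact: ltW.
  by split.
have ge1 (k D : R) : 1 <= k -> 0 <= D -> 1 <= k * growth_constant n * (far_constant n C1 C2 + D).
  move=> k1 D0; rewrite -[leLHS]mul1r; apply: ler_pM => //.
    by rewrite -[leLHS]mul1r; apply: ler_pM => //; exact: growth_constant_ge1.
  by rewrite ler_wpDr// far_constant_ge1.
have weak : 1 <= c3 n 0 (hedberg_constant n alpha) C1 C2 /\
    weak_riesz_bound n alpha Phi lambda Psi mu (c3 n 0 (hedberg_constant n alpha) C1 C2).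
  rewrite /c3 NE; split; first by apply: ge1; rewrite ?ler1n// mulr_ge0 ?(ltW CN0) ?(ltW C20).
  exact: (weak_riesz_bounded n0 alpha0 alphan oPhi oPsi lambda0 lambda1 mu0 mu1 C11 C21 H1 H2).
split; last first.
  split; last by move=> c0 _ _; exact: weak.
  by exists (c3 n 0 (hedberg_constant n alpha) C1 C2).
move=> dPhi; split.
  (* Bare existence of a constant: L comes from [Phi], so it may enter here but not in [C3]. *)
  have [L L1 growth] := Delta2_complementary_growth oPhi dPhi.
  have L0 : 0 < L by exact: lt_trans L1.
  exists (3 * growth_constant n * (4 * (far_constant n C1 C2 + L * near_constant (n := n) alpha * C2))).
  split; last exact: (riesz_bounded_growth n0 alpha0 alphan oPhi oPsi lambda0 lambda1 mu0 mu1 C11 C21 H1 H2).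
  rewrite mulrCA mulrA (mulrA 4); apply: ge1; first by rewrite -natrM ler1n.
  by apply: mulr_ge0; [apply: mulr_ge0; exact: ltW|exact: ltW].
move=> C0 C01 Hmax; rewrite /C3 NE /=.
have C00 : 0 < C0 by exact: lt_trans C01.
split; last exact: (riesz_bounded_maximal n0 alpha0 alphan oPhi oPsi lambda0 lambda1 mu0 mu1 C11 C21 H1 H2).
apply: ge1; first by rewrite ler1n.
by apply: mulr_ge0; [apply: mulr_ge0; exact: ltW|exact: ltW].
Qed.
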